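(* Let $I$ be a nonempty countable set and let $A\subset I\times I$ be a $(0,1)$-matrix with no zero rows. Assume that $A$ satisfies condition (L): every loop has at least one outgoing edge, and that $A$ is irreducible, in the sense that for each pair $(i,j)\in I\times I$ there is a finite path starting at $i$ and ending at $j$. Then the C$^*$-algebra $O_A$ is simple.
   Context: A subset $A\subset I\times I$ is identified with its characteristic function, a $(0,1)$-matrix; $A$ has no zero rows if for every $i\in I$ there is $j\in I$ with $(i,j)\in A$. A finite path is a finite sequence $(i_0,\dots,i_{r-1})$ in $I$ with $(i_k,i_{k+1})\in A$ for all $k$; it has length $r$. A loop is a finite path $(i_0,\dots,i_n)$ with $n\ge1$ and $i_n=i_0$; an outgoing edge of it is a pair $(i_k,j)\in A$, $0\le k<n$, with $j\ne i_{k+1}$. The space $X_A$. For $i\in I$ let $A_i=\{j\in I:(j,i)\in A\}$. Let $\mathcal J_A\subset\mathcal P(I)=\{0,1\}^I$ be the set of cluster points of $(A_i)_{i\in I}$ as $i\to\infty$ in the discrete set $I$: $J\in\mathcal J_A$ iff for all finite $E\subset J$ and $F\subset I\setminus J$ there are infinitely many $i\in I$ with $E\subset A_i$ and $F\cap A_i=\emptyset$ (so $\mathcal J_A=\emptyset$ if $I$ is finite). $X_A$ is the set of terminal paths: a terminal path is either an infinite path $(i_0,i_1,\dots)$ with $(i_k,i_{k+1})\in A$ for all $k$, or a pair $(i_0,\dots,i_{r-1};J)$, $r\ge 0$, where $(i_0,\dots,i_{r-1})$ is a finite path of length $r$ (empty if $r=0$), $J\in\mathcal J_A$, and $i_{r-1}\in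 J$ if $r\geq 1$. For a terminal path $x$ of length $\ge r$ put $I_r(x)=A_{i_r}$ if $x$ has length $>r$ ($i_r$ its entry of index $r$) and $I_r(x)=J$ if $x=(i_0,\dots,i_{r-1};J)$. $X_A$ has the coarsest topology for which all the sets $Z(\alpha)=\{x: x \text{ starts with }\alpha\}$ and $\{x\in Z(\alpha): j\in I_r(x)\}$ are open and closed ($\alpha$ a finite path of length $r\ge0$, $j\in I$); it is a compact, totally disconnected, second countable Hausdorff space. $T_A$ is the shift, defined on the set of terminal paths of length $\ge1$ by removing the first entry; it is a local homeomorphism from an open subset of $X_A$ onto an open subset. For a local homeomorphism $T$ from an open subset of a Hausdorff, second countable, locally compact space $X$ onto an open subset of $X$, $T^n$ is the $n$-fold composition on its natural domain, and $G(X,T)=\{(x,m-n,y): m,n\in\mathbf N, x\in\mathrm{dom}(T^m),y\in\mathrm{dom}(T^n),T^mx=T^ny\}$ with product $(x,k,y)(y,l,z)=(x,k+l,z)$, inverse $(x,k,y)^{-1}=(y,-k,x)$, and basic open sets $\{(x,m-n,y):(x,y)\in U\times V,T^mx=T^ny\}$ with $U,V$ open and $T^m|_U,T^n|_V$ injective. It is a Hausdorff étale locally compact groupoid; $C^*(X,T)=C^*(G(X,T))$ (full and reduced coincide). For $i\in I$, $S_i\in C^*(X_A,T_A)$ is the characteristic function of the compact open bisection $\{(x,1,T_Ax): x \text{ a terminal path starting with } i\}$, and $O_A$ is the sub-C$^*$-algebra of $C^*(X_A,T_A)$ generated by $\{S_i: i\in I\}$. *)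

(* Defs.v *)
From HB Require Import structures.
From mathcomp Require Import all_boot all_order all_algebra.
From mathcomp Require Import complex ring lra.
From mathcomp Require Import all_classical all_reals.
From mathcomp Require Import ereal topology normedtype numfun esum.
From mathcomp.analysis.showcase Require summability.

Set Implicit Arguments.
Unset Strict Implicit.
Unset Printing Implicit Defensive.

Import Order.TTheory GRing.Theory Num.Theory.
Import numFieldNormedType.Exports.

Local Open Scope classical_set_scope.
Local Open Scope ring_scope.
Local Open Scope complex_scope.

(* |z|^2 as an element of R: the norm of R[i] takes its values in R[i]. *)
Definition sqmod (R : realType) (z : R[i]) : R :=
  complex.Re z ^+ 2 + complex.Im z ^+ 2.

Definition square_summable (R : realType) (S : choiceType) : {pred S -> R[i]} :=
  fun f => `[< summable [set: S] (fun s => (sqmod (f s))%:E) >].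

Lemma sqmod_ge0 (R : realType) (z : R[i]) : 0 <= sqmod z.
Proof. by rewrite addr_ge0 // sqr_ge0. Qed.

Lemma sqmod_lin (R : realType) (a z w : R[i]) :
  sqmod (a * z + w) <= (2 * sqmod a) * sqmod z + 2 * sqmod w.
Proof.
case: a z w => [a b] [c d] [e f]; rewrite /sqmod /=.
rewrite -subr_ge0 [leRHS](_ : _ =
  (a * c - b * d - e) ^+ 2 + (a * d + b * c - f) ^+ 2); last by ring.
by rewrite addr_ge0 // sqr_ge0.
Qed.

Lemma summableZ (R : realType) (S : choiceType) (c : R) (f : S -> R) :
  (forall s, 0 <= f s) -> summable [set: S] (fun s => (f s)%:E) ->
  summable [set: S] (fun s => (c * f s)%:E).
Proof.
move=> f0 sf; rewrite /summable.
have absf : (\esum_(s in [set: S]) `|(f s)%:E|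
    = \esum_(s in [set: S]) (f s)%:E)%E.
  by apply: eq_esum => s _; rewrite gee0_abs// lee_fin.
apply: (@le_lt_trans _ _ (`|c|%:E * \esum_(s in [set: S]) (f s)%:E)%E).
  apply: ge_ereal_sup => _ [F [finF _] <-].
  under eq_fsbigr do rewrite EFinM abseM (@gee0_abs _ (f _)%:E) ?lee_fin//.
  rewrite -ge0_mule_fsumr => [|s]; last by rewrite lee_fin.
  apply: lee_wpmul2l; first by rewrite lee_fin.
  by apply: ereal_sup_ubound; exists F.
by apply: lte_mul_pinfty; rewrite ?lee_fin// -absf.
Qed.

Lemma square_summable_submod (R : realType) (S : choiceType) :
  GRing.submod_closed (@square_summable R S).
Proof.
split=> [|a f g].
  apply/asboolP; rewrite /summable esum1 ?ltry// => s _.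
  rewrite (_ : sqmod _ = 0); first exact: abse0.
  by rewrite /sqmod /= expr0n /= addr0.
move=> /asboolP sf /asboolP sg; apply/asboolP.
have ge0 (h : S -> R[i]) s : 0 <= sqmod (h s) by exact: sqmod_ge0.
have sfg := summableD (summableZ (2 * sqmod a) (ge0 f) sf)
                      (summableZ 2 (ge0 g) sg).
apply: le_lt_trans sfg; apply: le_esum => s _ /=.
rewrite lee_fin !ger0_norm ?sqmod_ge0 ?addr_ge0 ?mulr_ge0 ?sqmod_ge0 //.
exact: sqmod_lin.
Qed.

HB.instance Definition _ (R : realType) (S : choiceType) :=
  GRing.isSubmodClosed.Build R[i] (S -> R[i]) (@square_summable R S)
    (GRing.submod_closed_semi (@square_summable_submod R S)).

Record l2 (R : realType) (S : choiceType) := L2 {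
  l2val :> S -> R[i];
  l2valP : l2val \in @square_summable R S }.

HB.instance Definition _ (R : realType) (S : choiceType) :=
  [isSub for @l2val R S].
HB.instance Definition _ (R : realType) (S : choiceType) :=
  [Choice of l2 R S by <:].
HB.instance Definition _ (R : realType) (S : choiceType) :=
  [SubChoice_isSubLmodule of l2 R S by <:].

Definition l2norm (R : realType) (S : choiceType) (f : l2 R S) : R :=
  Num.sqrt (fine (\esum_(s in [set: S]) (sqmod (f s))%:E)).

(* Unordered sum: limit of the finite partial sums, along finite subsets. *)
Definition l2dot (R : realType) (S : choiceType) (f g : l2 R S) : R[i] :=
  summability.sum (fun s => f s * (g s)^* : R[i]^o).

Section OperatorAlgebras.
Variables (R : realType) (S : choiceType).
Local Notation H := (l2 R S).
Implicit Types (a b : H -> H) (M J : set (H -> H)).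

Definition bounded_operator a : Prop :=
  linear a /\ exists c : R, forall f, l2norm (a f) <= c * l2norm f.

Definition adjoint a b : Prop := forall f g, l2dot (a f) g = l2dot f (b g).

Definition norm_closure M : set (H -> H) :=
  [set a | bounded_operator a /\
    forall e : R, 0 < e ->
      exists2 b, M b & forall f, l2norm (a f - b f) <= e * l2norm f].

Record cstar_algebra M : Prop := {
  cstar_bounded : M `<=` bounded_operator;
  cstar_zero : M 0;
  cstar_add : forall a b, M a -> M b -> M (a + b);
  cstar_scale : forall (z : R[i]) a, M a -> M (z *: a);
  cstar_mul : forall a b, M a -> M b -> M (a \o b);
  cstar_adjoint : forall a b, M a -> bounded_operator b -> adjoint a b -> M b;
  cstar_closed : norm_closure M `<=` M }.

Record closed_ideal M J : Prop := {
  ideal_sub : J `<=` M;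
  ideal_zero : J 0;
  ideal_add : forall a b, J a -> J b -> J (a + b);
  ideal_scale : forall (z : R[i]) a, J a -> J (z *: a);
  ideal_mull : forall a b, M a -> J b -> J (a \o b);
  ideal_mulr : forall a b, J a -> M b -> J (a \o b);
  ideal_closed : norm_closure J `<=` J }.

Definition simple_cstar_algebra M : Prop :=
  [/\ cstar_algebra M, M != [set 0] &
      forall J, closed_ideal M J -> J = [set 0] \/ J = M].

End OperatorAlgebras.

(* T x = None means that x is not in the domain of T. *)
Definition partial_iter (X : Type) (T : X -> option X) (n : nat) (x : X) :
    option X :=
  iter n (obind T) (Some x).

(* T^m x = T^n y, both sides being defined. *)
Definition meet_at (X : Type) (T : X -> option X) (m n : nat) (x y : X) : Prop :=
  exists2 z, partial_iter T m x = Some z & partial_iter T n y = Some z.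

(* Arrow x k y _ is the triple (x,k,y): range x, source y. *)
Record groupoid (X : Type) (T : X -> option X) := Arrow {
  tgt : X;
  deg : int;
  src : X;
  arrowP : exists m n : nat, deg = m%:Z - n%:Z /\ meet_at T m n tgt src }.

HB.instance Definition _ (X : Type) (T : X -> option X) :=
  gen_eqMixin (groupoid T).
HB.instance Definition _ (X : Type) (T : X -> option X) :=
  gen_choiceMixin (groupoid T).

Definition injective_power (X : Type) (T : X -> option X) (n : nat)
    (U : set X) : Prop :=
  (forall x, U x -> partial_iter T n x <> None) /\
  (forall x y, U x -> U y -> partial_iter T n x = partial_iter T n y -> x = y).

Definition basic_open (X : topologicalType) (T : X -> option X) :
    set (set (groupoid T)) :=
  [set W | exists m n (U V : set X),
    [/\ open U, open V, injective_power T m U, injective_power T n V &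
        W = [set g | [/\ deg g = m%:Z - n%:Z, U (tgt g), V (src g) &
                         meet_at T m n (tgt g) (src g)]]]].

HB.instance Definition _ (X : topologicalType) (T : X -> option X) :=
  isSubBaseTopological.Build (groupoid T) (@basic_open X T) id.

Definition is_product (X : Type) (T : X -> option X) (g h k : groupoid T) :
    Prop :=
  [/\ src g = tgt h, tgt k = tgt g, deg k = deg g + deg h & src k = src h].

Definition Cc (R : realType) (X : topologicalType) (T : X -> option X) :
    set (groupoid T -> R[i]) :=
  [set f | continuous (f : groupoid T -> R[i]^o) /\
           compact (closure [set g | f g != 0])].

(* a is left convolution by f, (a xi)(k) = \sum_(g h = k) f(g) xi(h), i.e. the
   direct sum over the units x of the regular representations on l^2(src^-1 x).
   The sum has finitely many nonzero terms when f is in Cc. *)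
Definition left_convolution (R : realType) (X : Type) (T : X -> option X)
    (f : groupoid T -> R[i]) (a : l2 R (groupoid T) -> l2 R (groupoid T)) :
    Prop :=
  forall xi k, a xi k =
    \sum_(p \in [set p : groupoid T * groupoid T | is_product p.1 p.2 k])
      f p.1 * xi p.2.

(* C*(X,T), in its regular representation: the groupoid is amenable, so that
   the full and the reduced C*-algebras coincide. *)
Definition groupoid_cstar (R : realType) (X : topologicalType)
    (T : X -> option X) : set (l2 R (groupoid T) -> l2 R (groupoid T)) :=
  norm_closure [set a | bounded_operator a /\
                        exists2 f, Cc f & left_convolution f a].

Definition column (I : countType) (A : rel I) (i : I) : set I := [set j | A j i].

Definition column_cluster (I : countType) (A : rel I) : set (set I) :=
  [set J | forall E F : set I, finite_set E -> finite_set F ->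
     E `<=` J -> F `<=` ~` J ->
     infinite_set [set i | E `<=` column A i /\ F `&` column A i = set0]].

(* A finite path is a sequence s such that sorted A s; its length is size s. *)
Inductive raw_path (I : Type) :=
  | Infinite of nat -> I
  | Finite of seq I & set I.

Definition is_terminal (I : countType) (A : rel I) (x : raw_path I) : Prop :=
  match x with
  | Infinite p => forall k, A (p k) (p k.+1)
  | Finite s J => [/\ sorted A s, column_cluster A J &
                      forall s' i, s = rcons s' i -> J i]
  end.

Record terminal_path (I : countType) (A : rel I) := TerminalPath {
  path_of : raw_path I;
  path_ofP : is_terminal A path_of }.

HB.instance Definition _ (I : countType) (A : rel I) :=
  gen_eqMixin (terminal_path A).
HB.instance Definition _ (I : countType) (A : rel I) :=
  gen_choiceMixin (terminal_path A).

Definition starts_with (I : countType) (A : rel I) (alpha : seq I) :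
    set (terminal_path A) :=
  [set x | match path_of x with
           | Infinite p => alpha = mkseq p (size alpha)
           | Finite s _ => prefix alpha s
           end].

(* I_r(x); only meaningful for r at most the length of x. *)
Definition column_at (I : countType) (A : rel I) (r : nat)
    (x : terminal_path A) : set I :=
  match path_of x with
  | Infinite p => column A (p r)
  | Finite s J => if onth s r is Some i then column A i else J
  end.

Definition clopen_generators (I : countType) (A : rel I) :
    set (set (terminal_path A)) :=
  [set U | exists2 alpha, sorted A alpha &
     U = starts_with alpha \/
     exists j, U = starts_with alpha `&` [set x | column_at (size alpha) x j]].

(* Adding the complements to the subbase makes the generators clopen. *)
HB.instance Definition _ (I : countType) (A : rel I) :=
  isSubBaseTopological.Build (terminal_path A)
    [set U | clopen_generators U \/ clopen_generators (~` U)] id.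

Lemma is_terminal_shift_infinite (I : countType) (A : rel I) (p : nat -> I) :
  is_terminal A (Infinite p) -> is_terminal A (Infinite (fun k => p k.+1)).
Proof. by move=> Ap k; exact: Ap. Qed.

Lemma is_terminal_shift_finite (I : countType) (A : rel I) (i : I) (s : seq I)
    (J : set I) :
  is_terminal A (Finite (i :: s) J) -> is_terminal A (Finite s J).
Proof.
move=> [As clJ lastJ]; split=> //; first exact: path_sorted As.
by move=> s' j sE; apply: (lastJ (i :: s')); rewrite sE.
Qed.

Definition path_shift (I : countType) (A : rel I) (x : terminal_path A) :
    option (terminal_path A) :=
  match x with
  | TerminalPath (Infinite p) px =>
      Some (TerminalPath (is_terminal_shift_infinite px))
  | TerminalPath (Finite [::] J) _ => None
  | TerminalPath (Finite (i :: s) J) px =>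
      Some (TerminalPath (is_terminal_shift_finite px))
  end.

Definition S_fun (R : realType) (I : countType) (A : rel I) (i : I) :
    groupoid (@path_shift I A) -> R[i] :=
  \1_[set g | [/\ starts_with [:: i] (tgt g), deg g = 1 &
                  path_shift (tgt g) = Some (src g)]].

(* A C*-subalgebra of C*(X_A,T_A) is the same thing as a C*-algebra of operators
   contained in it, and the one generated by the S_i is contained in it since
   the S_i are. *)
Definition O_A (R : realType) (I : countType) (A : rel I) :
    set (l2 R (groupoid (@path_shift I A)) -> l2 R (groupoid (@path_shift I A))) :=
  smallest (@cstar_algebra R _)
    [set a | groupoid_cstar a /\ exists i, left_convolution (S_fun R i) a].

Definition no_zero_rows (I : countType) (A : rel I) : Prop :=
  forall i, exists j, A i j.

(* The loop (i_0, ..., i_n) is i0 :: s, with n = size s. *)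
Definition is_loop (I : countType) (A : rel I) (i0 : I) (s : seq I) : Prop :=
  [/\ s <> [::], path A i0 s & last i0 s = i0].

Definition has_outgoing_edge (I : countType) (A : rel I) (i0 : I) (s : seq I) :
    Prop :=
  exists k j, [/\ (k < size s)%N, A (nth i0 (i0 :: s) k) j &
                  j <> nth i0 (i0 :: s) k.+1].

Definition condition_L (I : countType) (A : rel I) : Prop :=
  forall i0 s, is_loop A i0 s -> has_outgoing_edge A i0 s.

Definition irreducible (I : countType) (A : rel I) : Prop :=
  forall i j, exists2 s, path A i s & last i s = j.

(* Main.v *)
(** Every element of O_A is a norm limit of linear combinations of words in the
   S_i and their adjoints, and a word acts on arrows through a partial
   homeomorphism alpha v |-> beta v of X_A, defined on a cylindrical set.

   Let J be a nonzero ideal. Some element of J has a nonzero matrix coefficient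
   between two arrows; multiplying it by a word yields a in J with a nonzero
   diagonal coefficient c at an arrow g. Approximate a by a span b of finitely
   many words. By (L) and irreducibility some vertex emits two edges, so close
   to the target of g there is an infinite path x with T^m x <> T^n x for all the
   distinct m, n that matter for these words. Hence for a long prefix alpha of x,
   compressing b by the projection P onto the cylinder of alpha gives the scalar
   multiple c' P with c' the diagonal coefficient of b at g. So c^-1 P a P is
   within 1/2 of P, which forces P to be in J; irreducibility then brings every
   S_i into J. *)
From mathcomp Require Import all_boot all_order all_algebra finmap.
From mathcomp Require Import complex ring lra.
From mathcomp Require Import all_classical all_reals.
From mathcomp Require Import ereal topology normedtype numfun esum.
From mathcomp.analysis.showcase Require summability.
Require Import Defs.

Set Implicit Arguments.
Unset Strict Implicit.
Unset Printing Implicit Defensive.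

Import Order.TTheory GRing.Theory Num.Theory.
Import numFieldNormedType.Exports.

Local Open Scope classical_set_scope.
Local Open Scope ring_scope.
Local Open Scope complex_scope.

(** * Square summable functions *)

Section L2.
Variables (R : realType) (S : choiceType).
Implicit Types (f g : l2 R S) (F : {fset S}).

(** Matrix coefficients at one arrow [g] do the work of a faithful conditional expectation onto the
    diagonal: only the coefficient at [g] is compared, and the aperiodic path is chosen for that [g]
    and that approximant. Two obstacles shape the proof. The target of [g] may be a finite terminal
    path [(s; J)], which has no tail to follow; there the definition of [J] as a cluster point of
    columns supplies infinitely many entries that can be appended to [s] without leaving a given
    neighbourhood. Moreover, [O_A] contains the [S_i] only in so far as they lie in
    [groupoid_cstar], so each [S_i] must be shown to be the characteristic function of a compact
    clopen bisection; compactness of the cylinders serves this purpose. Apart from that,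
    neighbourhoods in X_A are handled as finite lists of subbasic sets on which two paths agree. *)

Definition l2norm2 f : R := fine (\esum_(s in [set: S]) (sqmod (f s))%:E).

Lemma fsum_fset (x : S -> R) (A : set S) : finite_set A ->
  (\sum_(s \in A) (x s)%:E)%E = (\sum_(s <- fset_set A) x s)%:E.
Proof. by move=> fA; rewrite fsbig_finite// sumEFin. Qed.

Lemma square_summableP (x : S -> R[i]) (M : R) :
  (forall F, \sum_(s <- F) sqmod (x s) <= M) -> x \in @square_summable R S.
Proof.
move=> xM; apply/asboolP; rewrite /summable.
apply: (@le_lt_trans _ _ M%:E); last exact: ltry.
apply: ge_ereal_sup => _ [A [finA _] <-].
under eq_fsbigr do rewrite /= ger0_norm ?sqmod_ge0//.
by rewrite fsum_fset// lee_fin.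
Qed.

Lemma l2norm2E f :
  (\esum_(s in [set: S]) (sqmod (f s))%:E)%E = (l2norm2 f)%:E.
Proof.
rewrite /l2norm2 fineK// ge0_fin_numE.
  have /asboolP := l2valP f; rewrite /summable.
  by under eq_esum do rewrite /= ger0_norm ?sqmod_ge0//.
by apply: esum_ge0 => s _; rewrite lee_fin sqmod_ge0.
Qed.

Lemma l2norm2_ub f F : \sum_(s <- F) sqmod (f s) <= l2norm2 f.
Proof.
rewrite -lee_fin -l2norm2E; apply: ereal_sup_ubound.
exists [set` F]; first by split.
by rewrite fsum_fset// set_fsetK.
Qed.

Lemma l2norm2_ub_seq f (r : seq S) :
  uniq r -> \sum_(s <- r) sqmod (f s) <= l2norm2 f.
Proof.
move=> ur; rewrite (le_trans _ (l2norm2_ub f [fset s in r]%fset))//.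
rewrite [leRHS](perm_big r)//=; apply: uniq_perm => // s.
by rewrite !inE.
Qed.

Lemma l2norm2_le f (M : R) :
  (forall F, \sum_(s <- F) sqmod (f s) <= M) -> l2norm2 f <= M.
Proof.
move=> fM; rewrite -lee_fin -l2norm2E.
by apply: ge_ereal_sup => _ [A [finA _] <-]; rewrite fsum_fset// lee_fin.
Qed.

Lemma l2norm2_approx f (e : R) : 0 < e ->
  exists F, l2norm2 f - e < \sum_(s <- F) sqmod (f s).
Proof.
move=> e0; apply/not_existsP => fF.
suff: l2norm2 f <= l2norm2 f - e by rewrite lerDl oppr_ge0 leNgt e0.
by apply: l2norm2_le => F; rewrite leNgt; apply/negP/fF.
Qed.

Lemma l2norm2_ge0 f : 0 <= l2norm2 f.
Proof. by have := l2norm2_ub f fset0; rewrite big_seq_fset0. Qed.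

Lemma l2norm_ge0 f : 0 <= l2norm f.
Proof. exact: sqrtr_ge0. Qed.

Lemma sqr_l2norm f : l2norm f ^+ 2 = l2norm2 f.
Proof. by rewrite sqr_sqrtr// l2norm2_ge0. Qed.

Lemma l2norm_leP f (c : R) : 0 <= c -> (l2norm f <= c) = (l2norm2 f <= c ^+ 2).
Proof. by move=> c0; rewrite -sqr_l2norm ler_sqr// nnegrE// l2norm_ge0. Qed.

Lemma sqmod_coord f s : sqmod (f s) <= l2norm2 f.
Proof. by have := l2norm2_ub_seq f (r := [:: s]) isT; rewrite big_seq1. Qed.

Lemma sqmod_eq0 (z : R[i]) : sqmod z = 0 -> z = 0.
Proof.
case: z => a b; rewrite /sqmod /= => /eqP.
by rewrite paddr_eq0 ?sqr_ge0// !sqrf_eq0 => /andP[/eqP -> /eqP ->].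
Qed.

Lemma l2P f g : (forall s, f s = g s) -> f = g.
Proof. by move=> fg; apply: val_inj; apply/funext => s; exact: fg. Qed.

Lemma l2norm_eq0 f : l2norm f = 0 -> f = 0.
Proof.
move=> f0; apply: l2P => s; apply: sqmod_eq0; apply/eqP.
by rewrite eq_le sqmod_ge0 (le_trans (sqmod_coord f s))// -sqr_l2norm f0 expr0n.
Qed.

Lemma l2DE f g s : (f + g) s = f s + g s. Proof. by []. Qed.
Lemma l2ZE (c : R[i]) f s : (c *: f) s = c * f s. Proof. by []. Qed.
Lemma l2BE f g s : (f - g) s = f s - g s. Proof. by []. Qed.
Lemma l20E s : (0 : l2 R S) s = 0. Proof. by []. Qed.

Lemma sqmodM (z w : R[i]) : sqmod (z * w) = sqmod z * sqmod w.
Proof. by case: z w => [a b] [c d]; rewrite /sqmod /=; ring. Qed.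

Lemma l2norm2Z (c : R[i]) f : l2norm2 (c *: f) = sqmod c * l2norm2 f.
Proof.
have le d h : l2norm2 (d *: h) <= sqmod d * l2norm2 h.
  apply: l2norm2_le => F; under eq_bigr do rewrite l2ZE sqmodM.
  by rewrite -mulr_sumr ler_wpM2l ?sqmod_ge0// l2norm2_ub.
apply/eqP; rewrite eq_le le /=.
have [->|c0] := eqVneq c 0.
  by rewrite [X in X * _](_ : _ = 0) ?mul0r ?l2norm2_ge0// /sqmod /= expr0n addr0.
(* The reverse inequality is [le] for the inverse scalar, applied to [c *: f]. *)
have := le c^-1 (c *: f); rewrite scalerA mulVf// scale1r => /(ler_wpM2l (sqmod_ge0 c)).
rewrite mulrA -sqmodM mulfV// [X in _ <= X * _ -> _](_ : _ = 1) ?mul1r//.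
by rewrite /sqmod /= expr0n addr0 expr1n.
Qed.

Lemma l2normZ (c : R[i]) f : l2norm (c *: f) = Num.sqrt (sqmod c) * l2norm f.
Proof. by rewrite /l2norm -!/(l2norm2 _) l2norm2Z sqrtrM// sqmod_ge0. Qed.

Lemma l2normN f : l2norm (- f) = l2norm f.
Proof.
rewrite -scaleN1r l2normZ [X in Num.sqrt X](_ : _ = 1) ?sqrtr1 ?mul1r//.
by rewrite /sqmod /= oppr0 expr0n addr0 sqrrN expr1n.
Qed.

Lemma l2norm0 : l2norm (0 : l2 R S) = 0.
Proof.
by rewrite -(scale0r (0 : l2 R S)) l2normZ /sqmod /= expr0n addr0 sqrtr0 mul0r.
Qed.

(** Pointwise, the right side minus the left is |t f - g|^2 / t. Such weighted bounds sum over
    finite sets without Cauchy-Schwarz, and a suitable [t] turns them into the triangle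
    inequality. *)
Lemma l2norm2D_weighted (t : R) f g : 0 < t ->
  l2norm2 (f + g) <= (1 + t) * l2norm2 f + (1 + t^-1) * l2norm2 g.
Proof.
move=> t0; apply: l2norm2_le => F.
have tV : 0 < t^-1 by rewrite invr_gt0.
apply: (@le_trans _ _ (\sum_(s <- F)
    ((1 + t) * sqmod (f s) + (1 + t^-1) * sqmod (g s)))).
  apply: ler_sum => s _; rewrite l2DE.
  case: (f s) (g s) => [a b] [c d]; rewrite /sqmod /= -subr_ge0.
  rewrite [leRHS](_ : _ = t^-1 * ((t * a - c) ^+ 2 + (t * b - d) ^+ 2)).
    by rewrite mulr_ge0 ?(ltW tV)// addr_ge0// sqr_ge0.
  by field; rewrite gt_eqF.
rewrite big_split /= -!mulr_sumr lerD// ler_wpM2l ?l2norm2_ub//.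
  by rewrite addr_ge0// ltW.
by rewrite addr_ge0// ltW.
Qed.

Lemma l2normD f g : l2norm (f + g) <= l2norm f + l2norm g.
Proof.
have [/l2norm_eq0 ->|f0] := eqVneq (l2norm f) 0.
  by rewrite add0r lerDr l2norm_ge0.
have [/l2norm_eq0 ->|g0] := eqVneq (l2norm g) 0.
  by rewrite addr0 lerDl l2norm_ge0.
have fp : 0 < l2norm f by rewrite lt_def f0 l2norm_ge0.
have gp : 0 < l2norm g by rewrite lt_def g0 l2norm_ge0.
rewrite l2norm_leP ?addr_ge0 ?l2norm_ge0//.
(* The weight t = |g| / |f| is optimal: the bound becomes exactly (|f| + |g|)^2. *)
apply: le_trans (l2norm2D_weighted f g (divr_gt0 gp fp)) _.
rewrite -!sqr_l2norm invf_div le_eqVlt; apply/orP; left; apply/eqP.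
by field; rewrite f0 g0.
Qed.

Lemma l2normB f g : l2norm (f - g) <= l2norm f + l2norm g.
Proof. by rewrite (le_trans (l2normD _ _))// l2normN. Qed.

Lemma l2norm_dist f g : `|l2norm f - l2norm g| <= l2norm (f + g).
Proof.
have h (u v : l2 R S) : l2norm u - l2norm v <= l2norm (u + v).
  by rewrite lerBlDr -{1}(addrK v u) l2normB.
by rewrite ler_norml h andbT lerNl opprB (addrC f) h.
Qed.

End L2.

(** * Operators induced by partial injections of the index set *)

Section Pull.
Variables (R : realType) (S : choiceType).
Implicit Types (f g : l2 R S) (F : {fset S}) (sg tau : S -> option S).

Definition partial_injection sg : Prop :=
  forall s t u, sg s = Some u -> sg t = Some u -> s = t.

(** Composition with a partial map, extended by zero. The default of [insubd] would apply to a
    function that is not square summable, which injectivity of [sg] excludes. *)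
Definition pull sg f : l2 R S :=
  insubd 0 (fun s => if sg s is Some t then f t else 0).

Lemma sum_pmap (x : S -> R) sg (r : seq S) :
  \sum_(s <- r) (if sg s is Some t then x t else 0) = \sum_(t <- pmap sg r) x t.
Proof.
elim: r => [|s r IH] /=; first by rewrite !big_nil.
by rewrite big_cons IH; case: (sg s) => [t|] /=; rewrite ?add0r ?big_cons.
Qed.

Lemma uniq_pmap sg (r : seq S) : partial_injection sg -> uniq r -> uniq (pmap sg r).
Proof.
move=> isg; elim: r => //= s r IH /andP[sr /IH ur].
case E: (sg s) => [t|] //=; rewrite ur andbT mem_pmap.
by apply: contra sr => /mapP[s' s'r E']; rewrite (isg _ _ _ E (esym E')).
Qed.

Lemma pull_sum_le sg f F : partial_injection sg ->
  \sum_(s <- F) sqmod (if sg s is Some t then f t else 0) <= l2norm2 f.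
Proof.
move=> isg; rewrite (eq_bigr (fun s => if sg s is Some t then sqmod (f t) else 0)).
  by rewrite sum_pmap l2norm2_ub_seq// uniq_pmap// fset_uniq.
by move=> s _; case: (sg s) => //; rewrite /sqmod /= expr0n addr0.
Qed.

Lemma pullE sg f s : partial_injection sg ->
  pull sg f s = if sg s is Some t then f t else 0.
Proof.
move=> isg; rewrite -[LHS]/(val (pull sg f) s) /pull insubdK//.
exact: square_summableP (fun F => pull_sum_le f F isg).
Qed.

Lemma l2norm_pull sg f : partial_injection sg -> l2norm (pull sg f) <= l2norm f.
Proof.
move=> isg; rewrite l2norm_leP ?l2norm_ge0// sqr_l2norm; apply: l2norm2_le => F.
by under eq_bigr do rewrite pullE//; exact: pull_sum_le.
Qed.

Lemma pull_linear sg : partial_injection sg -> linear (pull sg).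
Proof.
move=> isg c f g; apply: l2P => s; rewrite pullE// l2DE l2ZE !pullE//.
by case: (sg s) => //; rewrite mulr0 addr0.
Qed.

Lemma partial_injection_comp sg tau : partial_injection sg ->
  partial_injection tau -> partial_injection (obind tau \o sg).
Proof.
move=> isg itau s t u /=; case E: (sg s) => [s'|] //=; case E': (sg t) => [t'|] //=.
by move=> /itau H /H ?; subst t'; apply: (isg _ _ _ E).
Qed.

Lemma pull_comp sg tau : partial_injection sg -> partial_injection tau ->
  pull sg \o pull tau = pull (obind tau \o sg).
Proof.
move=> isg itau; apply/funext => f; apply: l2P => s.
rewrite (pullE _ _ (partial_injection_comp isg itau)) /= pullE//.
by case: (sg s) => //= t; rewrite pullE.
Qed.

Definition delta (s : S) : l2 R S := insubd 0 (fun t => (t == s)%:R).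

Lemma sqmod_nat (b : bool) : sqmod (b%:R : R[i]) = b%:R.
Proof. by case: b; rewrite /sqmod /= expr0n addr0 ?expr1n ?expr0n. Qed.

Lemma delta_sum_le s F : \sum_(t <- F) sqmod ((t == s)%:R : R[i]) <= 1.
Proof.
under eq_bigr do rewrite sqmod_nat.
have [sF|sF] := boolP (s \in F).
  rewrite (perm_big _ (perm_to_rem sF)) big_cons eqxx big1_seq => [|t'].
    by rewrite -[leLHS]/(1 + 0) addr0.
  by rewrite mem_rem_uniq ?fset_uniq// inE => /andP[_ /andP[/negPf ->]].
by rewrite big1_seq// => t' /andP[_ t'F]; rewrite (_ : (t' == s) = false)//;
  apply/negP => /eqP ts; rewrite -ts t'F in sF.
Qed.

Lemma deltaE s t : delta s t = (t == s)%:R.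
Proof.
rewrite -[LHS]/(val (delta s) t) /delta insubdK//.
exact: (square_summableP (delta_sum_le s)).
Qed.

Lemma l2norm_delta s : l2norm (delta s) <= 1.
Proof.
rewrite l2norm_leP// expr1n; apply: l2norm2_le => F.
by under eq_bigr do rewrite deltaE; exact: delta_sum_le.
Qed.

Definition trunc (F : {fset S}) f : l2 R S := \sum_(s <- F) f s *: delta s.

Lemma truncE F f t : trunc F f t = if t \in F then f t else 0.
Proof.
have valsum (r : seq S) : (\sum_(s <- r) f s *: delta s : l2 R S) t =
    \sum_(s <- r) f s * (t == s)%:R.
  by elim: r => [|s r IH]; rewrite ?big_nil// !big_cons l2DE IH l2ZE deltaE.
rewrite /trunc valsum.
case: ifPn => tF.
  rewrite (perm_big _ (perm_to_rem tF)) big_cons eqxx mulr1 big1_seq => [|s].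
    by rewrite -[LHS]/(f t + 0) addr0.
  rewrite mem_rem_uniq ?fset_uniq// inE eq_sym => /andP[_ /andP[/negPf -> _]].
  by rewrite mulr0.
rewrite big1_seq// => s /andP[_ sF].
have [ts|] := eqVneq t s; last by rewrite mulr0.
by rewrite ts sF in tF.
Qed.

Lemma trunc_approx f (e : R) : 0 < e -> exists F, l2norm (f - trunc F f) <= e.
Proof.
move=> e0; have [F Fe] := l2norm2_approx f (exprn_gt0 2 e0).
exists F; rewrite (l2norm_leP _ (ltW e0)); apply: l2norm2_le => F'.
rewrite (eq_bigr (fun s => if s \notin F then sqmod (f s) else 0)); last first.
  move=> s _; rewrite l2BE truncE; case: (s \in F); rewrite /= ?subr0//.
  by rewrite subrr /sqmod /= expr0n addr0.
rewrite -big_mkcond -big_filter /=.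
have nF : ~~ has (mem F) [seq s <- F' | s \notin F].
  by apply/hasPn => s; rewrite mem_filter => /andP[].
(* [F] followed by the part of [F'] outside [F] has no repetition, so the sum over that part is at
   most the squared norm minus the sum over [F]. *)
have := l2norm2_ub_seq f (r := F ++ [seq s <- F' | s \notin F]).
rewrite cat_uniq fset_uniq filter_uniq ?fset_uniq//= nF big_cat /= => /(_ isT) h.
by rewrite -(lerD2l (\sum_(s <- F) sqmod (f s))) (le_trans h)// -lerBlDr ltW.
Qed.

End Pull.

(** * Inner products by polarization, and adjoints *)

Section Dot.
Variables (R : realType) (S : choiceType).
Implicit Types (f g h : l2 R S) (F : {fset S}).
Local Notation psum x := (@summability.partial_sum S R[i]^o x).
Local Notation tot := (@summability.totally S).
Existing Instance summability.totally_filter.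

Lemma partial_sumE (x : S -> R[i]) F :
  psum x F = \sum_(s <- F) x s.
Proof. by rewrite /summability.partial_sum big_seq_fsetE. Qed.

Lemma normc_real (x : R) : `|x%:C| = `|x|%:C.
Proof. by rewrite normc_def /= expr0n addr0 sqrtr_sqr. Qed.

(** Partial sums of nonnegative terms grow with [F], so once close to the supremum they stay close;
    this links [\esum] with the limit that defines [l2dot]. *)
Lemma cvg_sum_sqmod f :
  psum (fun s => (sqmod (f s))%:C) @ tot --> ((l2norm2 f)%:C : R[i]^o).
Proof.
apply/cvgrPdist_lt => -[e e'] /=; rewrite ltcE /= => /andP[/eqP -> e0].
have [F Fe] := l2norm2_approx f e0.
exists F => // F' /= FF'; rewrite partial_sumE.
rewrite -(rmorph_sum (@real_complex R)) -rmorphB normc_real ltcR ger0_norm.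
  rewrite ltrBlDr addrC -ltrBlDr (lt_le_trans Fe)//.
  have pF : perm_eq F [seq s <- F' | s \in F].
    apply: uniq_perm; rewrite ?filter_uniq ?fset_uniq// => s.
    by rewrite mem_filter andb_idr// => /(fsubsetP FF').
  rewrite (perm_big _ pF) /= big_filter [leRHS](bigID (mem F)) /= lerDl.
  by apply: sumr_ge0 => s _; exact: sqmod_ge0.
by rewrite subr_ge0 l2norm2_ub.
Qed.

Lemma cvg_mull (c : R[i]) (x : {fset S} -> R[i]) (l : R[i]) :
  x @ tot --> (l : R[i]^o) -> (fun F => c * x F) @ tot --> (c * l : R[i]^o).
Proof. exact: (@cvgZl_tmp _ R[i]^o). Qed.

Lemma cvg_addc (x y : {fset S} -> R[i]) (k l : R[i]) :
  x @ tot --> (k : R[i]^o) -> y @ tot --> (l : R[i]^o) ->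
  (fun F => x F + y F) @ tot --> (k + l : R[i]^o).
Proof. exact: (@cvgD _ R[i]^o). Qed.

Lemma cvg_subc (x y : {fset S} -> R[i]) (k l : R[i]) :
  x @ tot --> (k : R[i]^o) -> y @ tot --> (l : R[i]^o) ->
  (fun F => x F - y F) @ tot --> (k - l : R[i]^o).
Proof. exact: (@cvgB _ R[i]^o). Qed.

(** The polarization identity for a form that is conjugate linear in its second argument. Through
    it, the convergence and the value of [l2dot] reduce to squared norms. *)
Definition polarization (p q r s : R[i]) : R[i] :=
  4^-1 * (p - q + 'i * (r - s)).

Definition polarized_dot f g : R[i] :=
  polarization (l2norm2 (f + g))%:C (l2norm2 (f - g))%:C
        (l2norm2 (f + 'i *: g))%:C (l2norm2 (f - 'i *: g))%:C.

Lemma sqmod_polarization (z w : R[i]) :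
  z * w^* = polarization (sqmod (z + w))%:C (sqmod (z - w))%:C
        (sqmod (z + 'i * w))%:C (sqmod (z - 'i * w))%:C.
Proof.
apply: (@mulfI _ (4 : R[i])); first by rewrite pnatr_eq0.
rewrite /polarization [RHS]mulrA mulfV ?pnatr_eq0// mul1r.
have -> : (4 : R[i]) = 4%:C by rewrite rmorph_nat.
case: z w => [a b] [c d]; rewrite /sqmod; apply/eqP; rewrite eq_complex /=.
by apply/andP; split; apply/eqP; ring.
Qed.

Lemma dot_cvg f g : psum (fun s => f s * (g s)^*) @ tot --> (polarized_dot f g : R[i]^o).
Proof.
rewrite (_ : psum _ = fun F => polarization
   (psum (fun s => (sqmod ((f + g) s))%:C) F)
   (psum (fun s => (sqmod ((f - g) s))%:C) F)
   (psum (fun s => (sqmod ((f + 'i *: g) s))%:C) F)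
   (psum (fun s => (sqmod ((f - 'i *: g) s))%:C) F)); last first.
  apply/funext => F; rewrite !partial_sumE /polarization -!sumrB mulr_sumr -big_split.
  by rewrite mulr_sumr; apply: eq_bigr => s _; exact: sqmod_polarization.
rewrite /polarized_dot /polarization.
refine (cvg_mull (cvg_addc (cvg_subc _ _) (cvg_mull (cvg_subc _ _))));
exact: cvg_sum_sqmod.
Qed.

Lemma l2dot_lim f g (l : R[i]) :
  psum (fun s => f s * (g s)^*) @ tot --> (l : R[i]^o) -> l2dot f g = l.
Proof. by move=> h; apply: (cvg_lim _ h); exact: norm_hausdorff. Qed.

Lemma l2dotE f g : l2dot f g = polarized_dot f g.
Proof. exact/l2dot_lim/dot_cvg. Qed.

Lemma l2dot_cvg f g :
  psum (fun s => f s * (g s)^*) @ tot --> (l2dot f g : R[i]^o).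
Proof. by rewrite l2dotE; exact: dot_cvg. Qed.

Lemma l2dotDl f f' g : l2dot (f + f') g = l2dot f g + l2dot f' g.
Proof.
apply: l2dot_lim; rewrite (_ : psum _ = fun F =>
  psum (fun s => f s * (g s)^*) F + psum (fun s => f' s * (g s)^*) F);
  first by refine (cvg_addc _ _); exact: l2dot_cvg.
apply/funext => F /=; rewrite !partial_sumE -big_split; apply: eq_bigr => s _.
by rewrite mulrDl.
Qed.

Lemma l2dotDr f g g' : l2dot f (g + g') = l2dot f g + l2dot f g'.
Proof.
apply: l2dot_lim; rewrite (_ : psum _ = fun F =>
  psum (fun s => f s * (g s)^*) F + psum (fun s => f s * (g' s)^*) F);
  first by refine (cvg_addc _ _); exact: l2dot_cvg.
apply/funext => F /=; rewrite !partial_sumE -big_split; apply: eq_bigr => s _.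
by rewrite rmorphD mulrDr.
Qed.

Lemma l2dotZl (c : R[i]) f g : l2dot (c *: f) g = c * l2dot f g.
Proof.
apply: l2dot_lim; rewrite (_ : psum _ = fun F => c * psum (fun s => f s * (g s)^*) F).
  by refine (cvg_mull _); exact: l2dot_cvg.
apply/funext => F /=; rewrite !partial_sumE mulr_sumr; apply: eq_bigr => s _.
by rewrite mulrA.
Qed.

Lemma l2dotZr (c : R[i]) f g : l2dot f (c *: g) = c^* * l2dot f g.
Proof.
apply: l2dot_lim; rewrite (_ : psum _ = fun F => c^* * psum (fun s => f s * (g s)^*) F).
  by refine (cvg_mull _); exact: l2dot_cvg.
apply/funext => F /=; rewrite !partial_sumE mulr_sumr; apply: eq_bigr => s _.
by rewrite rmorphM mulrCA.
Qed.

Lemma l2dot0l f : l2dot 0 f = 0.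
Proof. by rewrite -(scale0r f) l2dotZl mul0r. Qed.

Lemma l2dot0r f : l2dot f 0 = 0.
Proof. by rewrite -(scale0r f) l2dotZr rmorph0 mul0r. Qed.

Lemma l2dot_norm f : l2dot f f = (l2norm2 f)%:C.
Proof.
apply: l2dot_lim; rewrite (_ : (fun s => _) = fun s => (sqmod (f s))%:C).
  exact: cvg_sum_sqmod.
apply/funext => s; case: (f s) => a b; rewrite /sqmod.
by apply/eqP; rewrite eq_complex /=; apply/andP; split; apply/eqP; ring.
Qed.

Lemma Re_polarization (p q r s : R) : complex.Re (polarization p%:C q%:C r%:C s%:C) = 4^-1 * (p - q).
Proof.
rewrite /polarization (_ : 4^-1 = (4^-1)%:C); last by rewrite fmorphV rmorph_nat.
by rewrite /=; ring.
Qed.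

(** By polarization four times the left side is |f+g|^2 - |f-g|^2, and the two triangle inequalities
    bound this by (|f|+|g|)^2 - (|f|-|g|)^2. *)
Lemma l2dot_CS f g : complex.Re (l2dot f g) <= l2norm f * l2norm g.
Proof.
rewrite l2dotE Re_polarization.
have h1 : l2norm2 (f + g) <= (l2norm f + l2norm g) ^+ 2.
  by rewrite -l2norm_leP ?l2normD// addr_ge0 ?l2norm_ge0.
have h2 : (l2norm f - l2norm g) ^+ 2 <= l2norm2 (f - g).
  rewrite -sqr_l2norm -real_normK ?num_real// ler_sqr ?nnegrE ?l2norm_ge0//.
  by rewrite -(l2normN g) l2norm_dist.
have := lerB h1 h2; rewrite ler_pdivrMl//; lra.
Qed.

Lemma eq_l2dot f g f' g' : (forall s, f s * (g s)^* = f' s * (g' s)^*) ->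
  l2dot f g = l2dot f' g'.
Proof.
by move=> /funext e; rewrite /l2dot e.
Qed.

Lemma l2norm2_dot f g f' g' :
  (forall c : R[i], l2norm2 (f + c *: g) = l2norm2 (f' + c *: g')) ->
  l2dot f g = l2dot f' g'.
Proof.
move=> e; rewrite !l2dotE /polarized_dot -!scaleNr !e.
by have := (e 1, e (-1)); rewrite !scale1r !scaleN1r => -[-> ->].
Qed.

(** [pull tau] is isometric on the range of [pull sg], hence preserves inner products there by
    polarization; this takes the place of reindexing an unordered sum. The outer two equalities hold
    term by term. *)
Lemma adjoint_pull (sg tau : S -> option S) :
  (forall s t, sg s = Some t <-> tau t = Some s) ->
  @adjoint R S (pull sg) (pull tau).
Proof.
move=> st.
have isg : partial_injection sg.
  by move=> s t u /st E /st; rewrite E => -[].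
have itau : partial_injection tau.
  by move=> s t u /st E /st; rewrite E => -[].
have sts h : pull sg (pull tau (pull sg h)) = pull sg h.
  apply: l2P => s; rewrite !pullE//.
  case E: (sg s) => [t|]//; rewrite pullE//; move/st: (E) => ->.
  by rewrite pullE// E.
have tst h : pull tau (pull sg (pull tau h)) = pull tau h.
  apply: l2P => s; rewrite !pullE//.
  case E: (tau s) => [t|]//; rewrite pullE//; move/st: (E) => ->.
  by rewrite pullE// E.
(* Both maps are contractions and [pull sg] undoes [pull tau] on the range of [pull sg], so the norm
   can only stay the same. *)
have iso h : l2norm2 (pull sg h) = l2norm2 (pull tau (pull sg h)).
  apply/eqP; rewrite -!sqr_l2norm eqrXn2 ?l2norm_ge0// eq_le l2norm_pull// andbT.
  by rewrite -[X in l2norm X <= _]sts l2norm_pull.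
move=> f g; transitivity (l2dot (pull sg f) (pull sg (pull tau g))).
  apply: eq_l2dot => s; rewrite !pullE//.
  case E: (sg s) => [t|]; last by rewrite !mul0r.
  by rewrite pullE//; move/st: E => ->.
transitivity (l2dot (pull tau (pull sg f)) (pull tau (pull sg (pull tau g)))).
  apply: l2norm2_dot => c; rewrite (addrC (pull sg f)) -(pull_linear isg) iso.
  by rewrite pull_linear// pull_linear// addrC.
apply: eq_l2dot => s; rewrite tst !pullE//; case E: (tau s) => [t|];
  last by rewrite mul0r rmorph0 mulr0.
by rewrite pullE//; move/st: E => ->.
Qed.

End Dot.

(** * C*-algebras of operators *)

Section CStar.
Variables (R : realType) (S : choiceType).
Local Notation H := (l2 R S).
Implicit Types (a b : H -> H) (M J : set (H -> H)).

Lemma bounded_pos a : bounded_operator a ->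
  exists2 c : R, 0 < c & forall f, l2norm (a f) <= c * l2norm f.
Proof.
move=> [_ [c ac]]; exists (Num.max 1 c) => [|f]; first by rewrite lt_max ltr01.
by rewrite (le_trans (ac f))// ler_wpM2r ?l2norm_ge0// le_max lexx orbT.
Qed.

Lemma opDE a b f : (a + b) f = a f + b f. Proof. by []. Qed.
Lemma opBE a b f : (a - b) f = a f - b f. Proof. by []. Qed.
Lemma opZE (z : R[i]) a f : (z *: a) f = z *: a f. Proof. by []. Qed.
Lemma op0E f : (0 : H -> H) f = 0. Proof. by []. Qed.

Lemma bounded_operatorD a b :
  bounded_operator a -> bounded_operator b -> bounded_operator (a + b).
Proof.
move=> [la [c ac]] [lb [d bd]]; split.
  by move=> k f g; rewrite !opDE la lb scalerDr addrACA.
by exists (c + d) => f; rewrite mulrDl opDE (le_trans (l2normD _ _))// lerD.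
Qed.

Lemma bounded_operatorZ (z : R[i]) a : bounded_operator a -> bounded_operator (z *: a).
Proof.
move=> [la [c ac]]; split.
  by move=> k f g; rewrite !opZE la scalerDr !scalerA mulrC.
exists (Num.sqrt (sqmod z) * c) => f.
by rewrite -mulrA opZE l2normZ ler_wpM2l ?sqrtr_ge0.
Qed.

Lemma bounded_operator0 : bounded_operator (0 : H -> H).
Proof.
split; first by move=> k f g; rewrite !op0E scaler0 addr0.
by exists 0 => f; rewrite mul0r op0E l2norm0.
Qed.

Lemma bounded_operator_comp a b :
  bounded_operator a -> bounded_operator b -> bounded_operator (a \o b).
Proof.
move=> ha [lb [d bd]]; have [c c0 ac] := bounded_pos ha; split.
  by move=> k f g; rewrite !compE lb (proj1 ha).
by exists (c * d) => f; rewrite (le_trans (ac _))// -mulrA ler_wpM2l// ltW.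
Qed.

Lemma bounded_cstar : cstar_algebra (@bounded_operator R S).
Proof.
split=> //.
- exact: bounded_operator0.
- exact: bounded_operatorD.
- exact: bounded_operatorZ.
- exact: bounded_operator_comp.
- by move=> a [].
Qed.

(** The intersected family contains the algebra of all bounded operators, which makes the elements
    of the intersection bounded; the other clauses hold member by member. *)
Lemma smallest_cstar (G : set (H -> H)) : G `<=` @bounded_operator R S ->
  cstar_algebra (smallest (@cstar_algebra R S) G).
Proof.
move=> Gb; split.
- by move=> a; apply; split=> //; exact: bounded_cstar.
- by move=> M [cM _]; exact: cstar_zero.
- by move=> a b ha hb M [cM GM]; apply: (cstar_add cM); [exact: ha|exact: hb].
- by move=> z a ha M [cM GM]; apply: (cstar_scale cM); exact: ha.
- by move=> a b ha hb M [cM GM]; apply: (cstar_mul cM); [exact: ha|exact: hb].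
- move=> a b ha hb ab M [cM GM].
  by apply: (cstar_adjoint cM (a := a)) => //; exact: ha.
- move=> a [ba ha] M [cM GM]; apply: (cstar_closed cM); split=> // e /ha[b hb ab].
  by exists b => //; exact: hb.
Qed.

(* The powers of d = p - b tend to 0, and p - p d^n lies in J for every n. *)
Lemma ideal_approx M J p b : cstar_algebra M -> closed_ideal M J -> M p ->
  (forall f, l2norm (p f) <= l2norm f) -> (forall f, p (p f) = p f) -> J b ->
  (forall f, b (p f) = b f) ->
  (forall f, l2norm (p f - b f) <= 2^-1 * l2norm f) -> J p.
Proof.
move=> cM iJ Mp p1 pp Jb bp pb2.
have Mb := ideal_sub iJ Jb.
pose d := p - b.
(* [q n] is p d^n. Starting from [p] rather than from the identity keeps it in [M], which need not
   be unital. *)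
pose q := fix q n : H -> H := if n is n'.+1 then q n' \o d else p.
have Md : M d.
  by rewrite /d -scaleN1r; apply: cstar_add => //; exact: cstar_scale.
have Mq n : M (q n) by elim: n => //= n IH; exact: cstar_mul.
have qp n f : q n (p f) = q n f.
  by case: n => [|n]; rewrite ?pp// /= /d !opBE pp bp.
have qn n f : l2norm (q n f) <= 2^-1 ^+ n * l2norm f.
  elim: n f => [|n IH] f; first by rewrite expr0 mul1r.
  by rewrite (le_trans (IH _))// exprSr -mulrA ler_wpM2l ?exprn_ge0 ?invr_ge0 ?pb2.
have Jq n : J (p - q n).
  elim: n => [|n IH]; first by rewrite /= subrr; exact: (ideal_zero iJ).
  (* Since d = p - b and p d^n p = p d^n, one more factor [d] changes p d^n by p d^n b, which lies
     in [J]. *)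
  have -> : p - q n.+1 = (p - q n) + (q n \o b).
    apply/funext => f; rewrite -[LHS]/(p f - q n (p f - b f)).
    rewrite -[RHS]/(p f - q n f + q n (b f)).
    have lq := proj1 (cstar_bounded cM (Mq n)).
    have -> : p f - b f = (-1) *: b f + p f by rewrite scaleN1r addrC.
    by rewrite lq qp scaleN1r opprD opprK addrA addrAC.
  exact: (ideal_add iJ IH (ideal_mull iJ (Mq n) Jb)).
apply: (ideal_closed iJ); split; first exact: (cstar_bounded cM).
move=> e e0.
have [n ne] : exists n, 2^-1 ^+ n <= e.
  exists (Num.bound e^-1); rewrite exprVn -[leRHS]invrK lef_pV2 ?posrE ?invr_gt0 ?exprn_gt0//.
  exact/ltW/upper_nthrootP.
exists (p - q n) => // f.
by rewrite opBE opprD opprK addrA subrr add0r (le_trans (qn n f))// ler_wpM2r ?l2norm_ge0.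
Qed.

Lemma adjoint_sub a a' b b' : adjoint a b -> adjoint a' b' ->
  @adjoint R S (a - a') (b - b').
Proof.
move=> ab ab' f g; rewrite !opBE -(scaleN1r (a' f)) -(scaleN1r (b' g)).
by rewrite l2dotDl l2dotDr l2dotZl l2dotZr ab ab' rmorphN rmorph1.
Qed.

(** |b g|^2 = (b g, b g) = (a b g, g) <= e |b g| |g|, then divide by |b g|. It transfers
    approximations to adjoints. *)
Lemma adjoint_bound a b (e : R) : adjoint a b ->
  (forall f, l2norm (a f) <= e * l2norm f) ->
  forall g, l2norm (b g) <= e * l2norm g.
Proof.
move=> ab ae g; have [->|bg0] := eqVneq (l2norm (b g)) 0.
  by rewrite (le_trans _ (ae g))// l2norm_ge0.
have bg : 0 < l2norm (b g) by rewrite lt_def bg0 l2norm_ge0.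
rewrite -(ler_pM2l bg) -expr2 sqr_l2norm.
have -> : l2norm2 (b g) = complex.Re (l2dot (b g) (b g)) by rewrite l2dot_norm.
rewrite -ab (le_trans (l2dot_CS _ _))//.
by rewrite [leRHS]mulrCA [leRHS]mulrA ler_wpM2r ?l2norm_ge0.
Qed.

(** Adjoints appear existentially: one adjoint in [N] for each element is enough for the norm
    closure to contain every bounded adjoint of its elements. *)
Record star_algebra (N : set (H -> H)) : Prop := {
  star_bounded : N `<=` @bounded_operator R S;
  star_zero : N 0;
  star_add : forall a b, N a -> N b -> N (a + b);
  star_scale : forall (z : R[i]) a, N a -> N (z *: a);
  star_mul : forall a b, N a -> N b -> N (a \o b);
  star_adjoint : forall a, N a -> exists2 b, N b & adjoint a b }.

Lemma norm_closure_cstar N : star_algebra N -> cstar_algebra (norm_closure N).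
Proof.
move=> sN; split.
- by move=> a [].
- split=> [|e e0]; first exact: bounded_operator0.
  exists 0; first exact: star_zero.
  by move=> f; rewrite op0E subrr l2norm0 mulr_ge0 ?l2norm_ge0// ltW.
- move=> a b [ba ha] [bb hb]; split=> [|e e0]; first exact: bounded_operatorD.
  have e2 : 0 < e / 2 by rewrite divr_gt0.
  have [a' Na' a'e] := ha _ e2; have [b' Nb' b'e] := hb _ e2.
  exists (a' + b') => [|f]; first exact: star_add.
  rewrite !opDE opprD addrACA (le_trans (l2normD _ _))//.
  by rewrite [in leRHS](splitr e) mulrDl lerD.
- move=> z a [ba ha]; split=> [|e e0]; first exact: bounded_operatorZ.
  have k0 : 0 < 1 + Num.sqrt (sqmod z) by rewrite ltr_pwDl// sqrtr_ge0.
  have [a' Na' a'e] := ha _ (divr_gt0 e0 k0).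
  exists (z *: a') => [|f]; first exact: star_scale.
  rewrite !opZE -scalerBr l2normZ.
  apply: (@le_trans _ _ (Num.sqrt (sqmod z) * (e / (1 + Num.sqrt (sqmod z)) * l2norm f))).
    by rewrite ler_wpM2l ?sqrtr_ge0.
  rewrite mulrA ler_wpM2r ?l2norm_ge0// mulrCA ler_piMr ?(ltW e0)//.
  by rewrite ler_pdivrMr// mul1r lerDr.
- move=> a b [ba ha] [bb hb]; split=> [|e e0]; first exact: bounded_operator_comp.
  (* The error splits as a (b - b') + (a - a') b'. So [b'] is chosen first, relative to a bound [c]
     of [a], and then [a'], relative to a bound [d] of [b']. *)
  have [c c0 ac] := bounded_pos ba.
  have [b' Nb' b'e] := hb _ (divr_gt0 (divr_gt0 e0 (ltr0Sn _ 1)) c0).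
  have [d d0 bd] := bounded_pos (star_bounded sN Nb').
  have [a' Na' a'e] := ha _ (divr_gt0 (divr_gt0 e0 (ltr0Sn _ 1)) d0).
  exists (a' \o b') => [|f]; first exact: star_mul.
  have -> : (a \o b) f - (a' \o b') f = a (b f - b' f) + (a (b' f) - a' (b' f)).
    have -> : b f - b' f = (-1) *: b' f + b f by rewrite scaleN1r addrC.
    rewrite (proj1 ba) scaleN1r /comp addrA [X in _ = X + _](_ : _ = a (b f))//.
    by rewrite addrAC addNr add0r.
  rewrite (le_trans (l2normD _ _))// [in leRHS](splitr e) mulrDl lerD//.
    rewrite (le_trans (ac _))// -ler_pdivlMl// (le_trans (b'e f))//.
    by rewrite [leLHS]mulrAC mulrC.
  rewrite (le_trans (a'e _))// -ler_pdivlMl ?divr_gt0//.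
  rewrite (le_trans (bd _))// mulrA ler_wpM2r ?l2norm_ge0// invf_div.
  by rewrite divfK ?gt_eqF// divr_gt0.
- move=> a b [ba ha] bb ab; split=> // e e0.
  have [a' Na' a'e] := ha _ e0; have [b' Nb' ab'] := star_adjoint sN Na'.
  by exists b' => // f; apply: (adjoint_bound (adjoint_sub ab ab')).
- move=> a [ba ha]; split=> // e e0.
  have e2 : 0 < e / 2 by rewrite divr_gt0.
  have [b [bb hb] ab] := ha _ e2; have [c Nc bc] := hb _ e2.
  exists c => // f; rewrite -(subrKA (b f)) (le_trans (l2normD _ _))//.
  by rewrite [in leRHS](splitr e) mulrDl lerD.
Qed.

(** A bounded operator that kills all [delta] kills the truncations, which are dense. *)
Lemma operator_coord_neq0 a : bounded_operator a -> a <> 0 ->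
  exists s t, a (delta R s) t <> 0.
Proof.
move=> ba; apply: contra_notP => /forallNP na0.
have a0 s : a (delta R s) = 0.
  by apply: l2P => t; apply: contrapT => nz; apply: (na0 s); exists t.
have [c c0 ac] := bounded_pos ba.
apply/funext => f; rewrite op0E; apply: l2norm_eq0; apply/eqP.
rewrite eq_le l2norm_ge0 andbT; apply/ler_addgt0Pr => e e0; rewrite add0r.
have [F Fe] := trunc_approx f (divr_gt0 e0 c0).
have aF : a (trunc F f) = 0.
  rewrite /trunc; elim: (enum_fset F) => [|s r IH].
    rewrite big_nil -[RHS](addNr (a 0)) -(scaleN1r (a 0)) -(proj1 ba).
    by rewrite scaler0 addr0.
  by rewrite big_cons (proj1 ba) a0 IH scaler0 addr0.
have -> : a f = a (f - trunc F f).
  by rewrite addrC -scaleN1r (proj1 ba) aF scaler0 add0r.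
by rewrite (le_trans (ac _))// -ler_pdivlMl// mulrC.
Qed.

End CStar.

(** * Terminal paths and words *)

(** Makes a partial map out of a functional relation, so that removing and adding a letter come from
    one equation read in its two directions. *)
Definition rel_fun (X Y : Type) (P : X -> Y -> Prop) (x : X) : option Y :=
  if pselect (exists y, P x y) is left e then Some (projT1 (cid e)) else None.

Lemma rel_funP (X Y : Type) (P : X -> Y -> Prop) :
  (forall x y y', P x y -> P x y' -> y = y') ->
  forall x y, rel_fun P x = Some y <-> P x y.
Proof.
move=> uP x y; rewrite /rel_fun; case: pselect => [e|ne]; last first.
  by split=> // Pxy; exfalso; apply: ne; exists y.
split=> [[<-]|Pxy]; first exact: projT2 (cid e).
by congr Some; apply: (uP x) => //; exact: projT2 (cid e).
Qed.

(** Concatenation lives on raw paths, where no compatibility with [A] has to be carried along; the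
    equation [path_of x = raw_cons i (path_of y)] then covers infinite and finite paths at once. *)
Definition raw_cons (I : Type) (i : I) (x : raw_path I) : raw_path I :=
  match x with
  | Infinite p => Infinite (fun k => if k is k'.+1 then p k' else i)
  | Finite s J => Finite (i :: s) J
  end.

Fixpoint raw_cat (I : Type) (alpha : seq I) (x : raw_path I) : raw_path I :=
  if alpha is i :: alpha' then raw_cons i (raw_cat alpha' x) else x.

Lemma raw_cons_inj (I : Type) (i j : I) (x y : raw_path I) :
  raw_cons i x = raw_cons j y -> i = j /\ x = y.
Proof.
case: x y => [p|s J] [q|t K] //= [].
  move=> e; have e' k := congr1 (@^~ k) e; split; first exact: (e' 0%N).
  by congr Infinite; apply/funext => k; exact: (e' k.+1).
by move=> -> -> ->.
Qed.

Lemma raw_cat_cat (I : Type) (a b : seq I) (x : raw_path I) :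
  raw_cat (a ++ b) x = raw_cat a (raw_cat b x).
Proof. by elim: a => //= i a ->. Qed.

Lemma raw_cat_inj (I : Type) (a b : seq I) (x y : raw_path I) :
  size a = size b -> raw_cat a x = raw_cat b y -> a = b /\ x = y.
Proof.
elim: a b => [|i a IH] [|j b] //= [sab] e.
have [-> e'] := raw_cons_inj e.
by have [-> ->] := IH _ sab e'.
Qed.

Section Paths.
Variables (I : countType) (A : rel I).
Local Notation X := (terminal_path A).
Implicit Types (x y z v : X) (i j : I) (alpha beta : seq I).

Lemma terminal_path_inj x y : path_of x = path_of y -> x = y.
Proof.
by case: x y => [x hx] [y hy] /= e; subst y; congr TerminalPath; exact: Prop_irrelevance.
Qed.

Lemma path_shiftE x y :
  path_shift x = Some y <-> exists i, path_of x = raw_cons i (path_of y).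
Proof.
split=> [|[ i]]; case: x => -[p|[|j s] J] hx //=.
- move=> [<-]; exists (p 0%N) => /=; congr Infinite.
  by apply/funext => -[].
- by move=> [<-]; exists j.
- move=> e; congr Some; apply: terminal_path_inj => /=.
  case: y e => [[q|t K] hy] //= [->] /=.
  by congr Infinite; apply/funext => k.
- by case: y => [[q|t K] hy].
- move=> e; congr Some; apply: terminal_path_inj => /=.
  by case: y e => [[q|t K] hy] //= [_ -> ->].
Qed.

Lemma starts_with0 x : starts_with [::] x.
Proof. by rewrite /starts_with /=; case: (path_of x) => [p|s J] //; rewrite prefix0s. Qed.

Lemma starts_with_raw_cons i alpha x y : path_of x = raw_cons i (path_of y) ->
  forall j, starts_with (j :: alpha) x <-> i = j /\ starts_with alpha y.
Proof.
rewrite /starts_with /= => -> j; case: (path_of y) => [p|s J] /=.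
  rewrite (_ : mkseq _ _ = i :: mkseq p (size alpha)); last first.
    by rewrite /mkseq /= -[1%N]addn0 iotaDl -map_comp.
  by split=> [[<- <-]|[-> <-]].
by rewrite eq_sym; split=> [/andP[/eqP]|[-> ->]]; rewrite ?eqxx.
Qed.

Lemma terminal_path_consP x i alpha : starts_with (i :: alpha) x ->
  exists y, path_of x = raw_cons i (path_of y).
Proof.
case E: (path_shift x) => [y|].
  have /path_shiftE[j e] := E => /(starts_with_raw_cons alpha e)[<- _].
  by exists y.
by case: x E => -[p|[|j s] J] hx.
Qed.

Lemma starts_withP alpha x :
  starts_with alpha x <-> exists v, path_of x = raw_cat alpha (path_of v).
Proof.
elim: alpha x => [|i alpha IH] x.
  by split=> _; [exists x|exact: starts_with0].
split=> [h|[v]].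
  have [y e] := terminal_path_consP h.
  have /(starts_with_raw_cons alpha e)[_ /IH[v ev]] := h.
  by exists v; rewrite e ev.
move=> e.
(* A concatenation need not be terminal; this one is, being the tail of the terminal path [x]. *)
have [y ey] : exists y, path_of y = raw_cat alpha (path_of v).
  case: x e => -[p|s J] hx /= e.
    case E: (raw_cat alpha (path_of v)) e => [q|//] /= [e].
    have hq : is_terminal A (Infinite q).
      by move=> k; have := hx k.+1; rewrite e.
    by exists (TerminalPath hq).
  case E: (raw_cat alpha (path_of v)) e => [//|t K] /= [e1 e2]; subst s J.
  by exists (TerminalPath (is_terminal_shift_finite hx)).
have ex : path_of x = raw_cons i (path_of y) by rewrite ey.
by apply/(starts_with_raw_cons alpha ex); split=> //; apply/IH; exists v.
Qed.

Lemma column_at_cons x y i r : path_of x = raw_cons i (path_of y) ->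
  column_at r.+1 x = column_at r y.
Proof. by rewrite /column_at => ->; case: (path_of y). Qed.

Lemma column_at_cons0 x y i : path_of x = raw_cons i (path_of y) ->
  column_at 0 x = column A i.
Proof. by rewrite /column_at => ->; case: (path_of y). Qed.

Lemma column_at_starts x alpha r (h : (r < size alpha)%N) :
  starts_with alpha x -> forall i0, column_at r x = column A (nth i0 alpha r).
Proof.
elim: alpha x r h => [|i alpha IH] x r //= h sx i0.
have [y e] := terminal_path_consP sx.
have /(starts_with_raw_cons alpha e)[_ sy] := sx.
case: r h => [|r] h; first exact: column_at_cons0 e.
by rewrite (column_at_cons r e); exact: IH.
Qed.

Lemma column_at_cat alpha x v r : path_of x = raw_cat alpha (path_of v) ->
  column_at (size alpha + r) x = column_at r v.
Proof.
elim: alpha x => [|i alpha IH] x e; first by rewrite (terminal_path_inj e).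
have : starts_with (i :: alpha) x by apply/starts_withP; exists v.
move=> /terminal_path_consP[y ey]; rewrite addSn (column_at_cons _ ey); apply: IH.
by rewrite /= ey in e; have [_ ->] := raw_cons_inj e.
Qed.

(** Describes the domain of adding [i] through I_0(y), hence as a subbasic clopen set. For the empty
    path with cluster point [J], I_0(y) is [J] itself. *)
Lemma cons_terminal y i : column_at 0 y i <->
  exists x, path_of x = raw_cons i (path_of y).
Proof.
split=> [|[x]].
  case: y => -[p|[|j s] J] hy; rewrite /column_at /= => h.
  - have hx : is_terminal A (raw_cons i (Infinite p)) by case.
    by exists (TerminalPath hx).
  - have hx : is_terminal A (Finite [:: i] J).
      by case: hy => _ cJ _; split=> // -[|? [|]] //= k [<-].
    by exists (TerminalPath hx).
  - have hx : is_terminal A (Finite [:: i, j & s] J).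
      case: hy => sA cJ lJ; split=> //=; first by apply/andP.
      by move=> [|k s'] i' //= [_] /lJ.
    by exists (TerminalPath hx).
case: x => -[p|s J] hx; case: y => -[q|t K] hy //= [e].
  by rewrite /column_at /= /column /= -[q 0%N]/((fun k => if k is k'.+1 then q k' else i) 1%N)
    -e; have := hx 0%N; rewrite {1}e.
move=> e'; subst J s; rewrite /column_at /=.
case: t hx hy => [|j t] hx hy /=;
  first by case: hx => _ _; apply; exact: (erefl (rcons [::] i)).
by case: hx => /= /andP[].
Qed.

(* The letters (true, i) and (false, i) act as S_i and its adjoint do on the
   targets of arrows: the former removes the first entry i, the latter adds it. *)
Definition letter (l : bool * I) : X -> option X :=
  if l.1 then rel_fun (fun x y => path_of x = raw_cons l.2 (path_of y))
  else rel_fun (fun y x => path_of x = raw_cons l.2 (path_of y)).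

Lemma strip_letterP i x y :
  letter (true, i) x = Some y <-> path_of x = raw_cons i (path_of y).
Proof.
by apply: rel_funP => x' y' y'' -> e; apply: terminal_path_inj; have [_ ->] := raw_cons_inj e.
Qed.

Lemma add_letterP i x y :
  letter (false, i) y = Some x <-> path_of x = raw_cons i (path_of y).
Proof.
by apply: rel_funP => x' y' y'' e e'; apply: terminal_path_inj; rewrite e e'.
Qed.

Definition word : Type := seq (bool * I).

Fixpoint word_act (w : word) (x : X) : option X :=
  if w is l :: w' then obind (word_act w') (letter l x) else Some x.

Definition letter_inv (l : bool * I) : bool * I := (~~ l.1, l.2).
Definition word_inv (w : word) : word := rev (map letter_inv w).

Definition letter_deg (l : bool * I) : int := if l.1 then 1 else - 1.
Definition word_deg (w : word) : int := \sum_(l <- w) letter_deg l.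

Lemma word_act_cat w w' x : word_act (w ++ w') x = obind (word_act w') (word_act w x).
Proof. by elim: w x => //= l w IH x; case: (letter l x) => //=. Qed.

Lemma word_deg_cat w w' : word_deg (w ++ w') = word_deg w + word_deg w'.
Proof. by rewrite /word_deg big_cat. Qed.

Lemma letter_invP l x y : letter l x = Some y <-> letter (letter_inv l) y = Some x.
Proof.
case: l => -[] i; rewrite /letter_inv /=.
  by split=> [/strip_letterP /add_letterP|/add_letterP /strip_letterP].
by split=> [/add_letterP /strip_letterP|/strip_letterP /add_letterP].
Qed.

Lemma word_inv_cons l w : word_inv (l :: w) = word_inv w ++ [:: letter_inv l].
Proof. by rewrite /word_inv /= rev_cons cats1. Qed.

Lemma word_act_inv w x y : word_act w x = Some y <-> word_act (word_inv w) y = Some x.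
Proof.
elim: w x y => [|l w IH] x y; first by split=> -[->].
rewrite word_inv_cons word_act_cat /=; split.
  case E: (letter l x) => [z|] //= /IH -> /=.
  by rewrite (iffLR (letter_invP _ _ _) E).
case E: (word_act _ y) => [z|] //=.
case E': (letter _ z) => [x'|] //= [ex]; subst x'.
by rewrite (iffRL (letter_invP _ _ _) E') /=; exact/IH.
Qed.

Lemma word_deg_cons l w : word_deg (l :: w) = letter_deg l + word_deg w.
Proof. by rewrite /word_deg big_cons. Qed.

Lemma word_deg0 : word_deg [::] = 0. Proof. by rewrite /word_deg big_nil. Qed.

Lemma word_deg_inv w : word_deg (word_inv w) = - word_deg w.
Proof.
elim: w => [|l w IH]; first by rewrite word_deg0 oppr0.
rewrite word_inv_cons word_deg_cat IH !word_deg_cons word_deg0 addr0 opprD addrC.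
by congr (_ + _); case: l => -[] i.
Qed.

Definition strips alpha : word := [seq (true, i) | i <- alpha].

Lemma stripsP alpha x v :
  word_act (strips alpha) x = Some v <-> path_of x = raw_cat alpha (path_of v).
Proof.
elim: alpha x => [|i alpha IH] x /=.
  by split=> [[->//]|/terminal_path_inj ->].
split; first by case E: (letter _ x) => [y|] //= /IH <-; exact/strip_letterP.
move=> e; have : starts_with (i :: alpha) x by apply/starts_withP; exists v.
move=> /terminal_path_consP[y ey].
have /strip_letterP -> /= := ey.
by apply/IH; rewrite /= ey in e; have [_ ->] := raw_cons_inj e.
Qed.

Lemma word_deg_strips alpha : word_deg (strips alpha) = (size alpha)%:Z.
Proof.
elim: alpha => [|i alpha IH]; first by rewrite /word_deg big_nil.
by rewrite /word_deg /= big_cons -/(word_deg _) IH.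
Qed.

(** The word of S_alpha times its adjoint, that is, of the projection onto the cylinder of
    [alpha]. *)
Definition cylinder_word alpha : word := strips alpha ++ word_inv (strips alpha).

Lemma cylinder_wordP alpha x y :
  word_act (cylinder_word alpha) x = Some y <-> x = y /\ starts_with alpha x.
Proof.
rewrite word_act_cat; split.
  case E: (word_act _ x) => [v|] //= E'.
  split; last by apply/starts_withP; exists v; exact/stripsP.
  by move: E'; rewrite (iffLR (word_act_inv _ _ _) E) => -[].
move=> [<- /starts_withP[v /stripsP E]].
by rewrite E /=; exact: (iffLR (word_act_inv _ _ _) E).
Qed.

(* The subbasic clopen sets, without the requirement that d.1 be a path. *)
Definition basic_cylinder (d : seq I * option I) : set X :=
  [set x | starts_with d.1 x /\
           if d.2 is Some j then column_at (size d.1) x j else True].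

Definition agree (L : seq (seq I * option I)) x y : Prop :=
  forall d, d \in L -> basic_cylinder d x <-> basic_cylinder d y.

(** Boolean combinations of finitely many subbasic sets, encoded by finite determination so that
    combining two of them is list concatenation. *)
Definition cylindrical (P : set X) : Prop :=
  exists L, forall x y, agree L x y -> P x -> P y.

Lemma agree_cat L L' x y : agree (L ++ L') x y <-> agree L x y /\ agree L' x y.
Proof.
split=> [h|[h h'] d]; last by rewrite mem_cat => /orP[/h|/h'].
by split=> d dL; apply: h; rewrite mem_cat dL ?orbT.
Qed.

Lemma agree_sym L x y : agree L x y -> agree L y x.
Proof. by move=> h d /h[]. Qed.

Lemma agree_trans L x y z : agree L x y -> agree L y z -> agree L x z.
Proof. by move=> h h' d dL; exact: iff_trans (h _ dL) (h' _ dL). Qed.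

Lemma cylindrical_basic d : cylindrical (basic_cylinder d).
Proof. by exists [:: d] => x y h; apply: (iffLR (h d _)); rewrite ?mem_head. Qed.

Lemma cylindricalI P Q : cylindrical P -> cylindrical Q -> cylindrical (P `&` Q).
Proof.
move=> [L h] [L' h']; exists (L ++ L') => x y /agree_cat[a a'] [Px Qx].
by split; [exact: h Px|exact: h' Qx].
Qed.

Lemma cylindrical0 : cylindrical set0. Proof. by exists [::]. Qed.
Lemma cylindricalT : cylindrical setT. Proof. by exists [::]. Qed.

(** [D] may be smaller than the cylinder of [alpha]: adding a letter and removing it again changes
    no path, but is undefined where the letter cannot be added. *)
Definition normal_form (w : word) alpha beta (D : set X) : Prop :=
  [/\ cylindrical D, word_deg w = (size alpha)%:Z - (size beta)%:Z,
      forall x, D x -> exists v y, [/\ path_of x = raw_cat alpha (path_of v),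
        path_of y = raw_cat beta (path_of v) & word_act w x = Some y] &
      forall x, ~ D x -> word_act w x = None].

Lemma word_act_rcons w l x : word_act (rcons w l) x = obind (letter l) (word_act w x).
Proof. by rewrite -cats1 word_act_cat; case: (word_act w x) => //= y; case: (letter l y). Qed.

(** A further letter acts on the front of [beta]. A removed letter cancels the head of [beta], or
    the word becomes empty as a map; when [beta] is empty it is taken from [v], and [alpha] grows.
    An added letter goes in front of [beta] if [A] allows it; when [beta] is empty, this becomes a
    condition on I_r(x) with r the length of [alpha]. *)
Lemma word_normal_form w : exists alpha beta D, normal_form w alpha beta D.
Proof.
elim/last_ind: w => [|w l [alpha [beta [D [cD dw wD wND]]]]].
  exists [::], [::], setT; split=> //; first exact: cylindricalT.
    by rewrite word_deg0.
    by move=> x _; exists x, x.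
  by move=> x /(_ Logic.I).
have dl b i : word_deg (rcons w (b, i)) = (size alpha)%:Z - (size beta)%:Z + letter_deg (b, i).
  by rewrite -cats1 word_deg_cat dw word_deg_cons word_deg0 addr0.
case: l => -[] i.
- case: beta dw wD dl => [|j beta] dw wD dl.
    exists (rcons alpha i), [::], (D `&` basic_cylinder (rcons alpha i, None)); split.
    + exact/cylindricalI/cylindrical_basic.
    + by rewrite dl size_rcons /letter_deg /= -addn1 PoszD; ring.
    + move=> x [/wD[v [y [xv /terminal_path_inj yv wx]]] [/starts_withP[v' xv'] _]].
      exists v', v'; split=> //; rewrite word_act_rcons wx /=; apply/strip_letterP.
      rewrite /= in xv'; rewrite xv' -cats1 raw_cat_cat in xv.
      by have [_ e] := raw_cat_inj (erefl _) xv; rewrite yv -e.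
    + move=> x nDx; rewrite word_act_rcons.
      have [Dx|/wND -> //] := pselect (D x).
      have [v [y [xv /terminal_path_inj yv ->]]] := wD x Dx; subst y.
      case E: (obind _ _) => [v'|] //; exfalso; apply: nDx; split=> //; split=> //=.
      apply/starts_withP; exists v'; rewrite -cats1 raw_cat_cat xv; congr raw_cat.
      exact/strip_letterP.
  exists alpha, beta, (if i == j then D else set0); split.
  + by case: ifP => _ //; exact: cylindrical0.
  + by rewrite dl /letter_deg /= -addn1 PoszD; ring.
  + move=> x; case: eqVneq => [->|//] /wD[v [y [xv yv wx]]].
    have : starts_with (j :: beta) y by apply/starts_withP; exists v.
    move=> /terminal_path_consP[y' ey].
    have yv' := yv; rewrite ey /= in yv'; have [_ ey'] := raw_cons_inj yv'.
    by exists v, y'; split=> //; rewrite word_act_rcons wx /=; apply/strip_letterP.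
  + move=> x h; rewrite word_act_rcons.
    have [Dx|/wND -> //] := pselect (D x).
    have [v [y [xv yv ->]]] := wD x Dx => /=.
    case E: (letter _ y) => [y'|] //; exfalso; apply: h.
    by move/strip_letterP: E; rewrite yv /= => e; have [-> _] := raw_cons_inj e; rewrite eqxx.
- case: beta dw wD dl => [|j beta] dw wD dl.
    exists alpha, [:: i], (D `&` basic_cylinder (alpha, Some i)); split.
    + exact/cylindricalI/cylindrical_basic.
    + by rewrite dl /letter_deg /=; ring.
    + move=> x [/wD[v [y [xv /terminal_path_inj yv wx]]] [_ /= ci]]; subst y.
      move: ci; rewrite -[size _]addn0 (column_at_cat _ xv) => /cons_terminal[y ey].
      by exists v, y; split=> //; rewrite word_act_rcons wx /=; apply/add_letterP.
    + move=> x nDx; rewrite word_act_rcons.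
      have [Dx|/wND -> //] := pselect (D x).
      have [v [y [xv /terminal_path_inj yv ->]]] := wD x Dx; subst y.
      case E: (obind _ _) => [v'|] //; exfalso; apply: nDx; split=> //; split=> /=.
        by apply/starts_withP; exists v.
      rewrite -[size _]addn0 (column_at_cat _ xv); apply/cons_terminal.
      by exists v'; apply/add_letterP.
  exists alpha, [:: i, j & beta], (if A i j then D else set0); split.
  + by case: ifP => _ //; exact: cylindrical0.
  + by rewrite dl /letter_deg /= -addn1 PoszD; ring.
  + move=> x; case: ifP => // Aij /wD[v [y [xv yv wx]]].
    have sy : starts_with (j :: beta) y by apply/starts_withP; exists v.
    have [y' ey] := terminal_path_consP sy.
    have /cons_terminal[z ez] : column_at 0 y i by rewrite (column_at_cons0 ey).
    exists v, z; split=> //; first by rewrite ez yv.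
    by rewrite word_act_rcons wx /=; apply/add_letterP.
  + move=> x h; rewrite word_act_rcons.
    have [Dx|/wND -> //] := pselect (D x).
    have [v [y [xv yv ->]]] := wD x Dx => /=.
    case E: (letter _ y) => [z|] //; exfalso; apply: h.
    move/add_letterP: E => ez.
    have : column_at 0 y i by apply/cons_terminal; exists z.
    have sy : starts_with (j :: beta) y by apply/starts_withP; exists v.
    by have [y' ey] := terminal_path_consP sy; rewrite (column_at_cons0 ey) /column /= => ->.
Qed.

End Paths.

(** * Aperiodic paths *)


Section Extension.
Variables (I : countType) (A : rel I).
Local Notation X := (terminal_path A).
Hypotheses (hI : inhabited I) (hA : no_zero_rows A) (hL : condition_L A)
  (hirr : irreducible A).

(** Irreducibility closes an edge up to a loop, and an outgoing edge of that loop shares its source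
    with an edge of the loop. *)
Lemma branching : exists v c d, [/\ c <> d, A v c & A v d].
Proof.
case: hI => i; have [k Aik] := hA i; have [s ps ls] := hirr k i.
have [|n [j [ns Aj jn]]] := @hL i (k :: s); first by split=> //=; rewrite Aik.
exists (nth i (i :: k :: s) n), j, (nth i (i :: k :: s) n.+1); split=> //.
by move/(pathP i): ps => h; case: n ns {Aj jn} => [|n] //= /h.
Qed.

Lemma path_extend_size i0 s n : path A i0 s ->
  exists2 s', path A i0 (s ++ s') & (n <= size (s ++ s'))%N.
Proof.
move=> ps; elim: n => [|n [s' ps' ns']]; first by exists [::]; rewrite ?cats0.
have [j Aj] := hA (last i0 (s ++ s')); exists (rcons s' j).
  by rewrite -rcons_cat rcons_path ps'.
by rewrite -rcons_cat size_rcons.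
Qed.

(* The branching vertex leaves two choices for the entry of index n + k, one of
   which differs from the entry of index m + k. *)
Lemma path_separate i0 s m n : path A i0 s -> (m < n)%N ->
  exists2 s', path A i0 (s ++ s') & exists k, (n + k < size (i0 :: s ++ s'))%N /\
    nth i0 (i0 :: s ++ s') (m + k) <> nth i0 (i0 :: s ++ s') (n + k).
Proof.
move=> ps mn; have [s1 ps1 ns1] := path_extend_size n ps.
have [v [c [d [cd Avc Avd]]]] := branching.
have [s2 ps2 ls2] := hirr (last i0 (s ++ s1)) v.
set t := s ++ s1 ++ s2.
have pt : path A i0 t by rewrite /t catA cat_path ps1.
have lt : last i0 t = v by rewrite /t catA last_cat ls2.
have nt : (n <= size t)%N by rewrite /t catA size_cat (leq_trans ns1)// leq_addr.
pose k := ((size t).+1 - n)%N.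
have nk : (n + k = size (i0 :: t))%N by rewrite subnKC// ltnW.
have [e Ae ne] : exists2 e, A v e & nth i0 (i0 :: t) (m + k) <> e.
  have [h|h] := pselect (nth i0 (i0 :: t) (m + k) = c); last by exists c.
  by exists d => // h'; apply: cd; rewrite -h -h'.
exists (s1 ++ rcons s2 e).
  by rewrite -!rcons_cat rcons_path -/t pt lt.
exists k; rewrite -!rcons_cat -/t -rcons_cons size_rcons nk ltnSn; split=> //.
rewrite !nth_rcons -nk ltnn eqxx ifT//.
by rewrite ltn_add2r.
Qed.

(** A separation, once achieved, survives every further extension, so the pairs can be treated one
    at a time. *)
Lemma path_separate_all i0 s (ps : seq (nat * nat)) : path A i0 s ->
  (forall q, q \in ps -> (q.1 < q.2)%N) ->
  exists2 s', path A i0 (s ++ s') & forall q, q \in ps ->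
    exists k, (q.2 + k < size (i0 :: s ++ s'))%N /\
    nth i0 (i0 :: s ++ s') (q.1 + k) <> nth i0 (i0 :: s ++ s') (q.2 + k).
Proof.
move=> As; elim: ps => [|q ps IH] lt; first by exists [::]; rewrite ?cats0.
have [|s1 As1 h1] := IH; first by move=> q' q'ps; apply: lt; rewrite inE q'ps orbT.
have [s2 As2 h2] := path_separate As1 (lt q (mem_head _ _)).
exists (s1 ++ s2); rewrite catA// => q'; rewrite inE => /orP[/eqP -> //|q'ps].
have lt' : (q'.1 < q'.2)%N by apply: lt; rewrite inE q'ps orbT.
have [k [k1 k2]] := h1 _ q'ps; exists k; rewrite -cat_cons size_cat !nth_cat k1.
by rewrite (ltn_trans _ k1) ?ltn_add2r// ltn_addr.
Qed.

Lemma path_extend_infinite i0 s : path A i0 s -> exists p : nat -> I,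
  (forall k, A (p k) (p k.+1)) /\ forall k, (k <= size s)%N -> p k = nth i0 (i0 :: s) k.
Proof.
move=> ps; have [g gP] := choice hA.
exists (fun k => if (k <= size s)%N then nth i0 (i0 :: s) k
  else iter (k - size s) g (last i0 s)); split=> [k|k ->//].
case: ltnP => ks; first by rewrite ltnW//; move/pathP: ps; apply.
move: ks; rewrite leq_eqVlt => /orP[/eqP <-|ks].
  by rewrite leqnn subSnn /= -last_nth gP.
by rewrite leqNgt ks /= subSn ?(ltnW ks).
Qed.

(** T^m x and T^n x differ for m < n <= N, in terms of entries. With a bound [N], finitely many
    extensions of a finite path achieve this. *)
Definition aperiodic_upto (N : nat) (p : nat -> I) : Prop :=
  forall m n, (m < n <= N)%N -> exists k, p (m + k)%N <> p (n + k)%N.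

Lemma aperiodic_extension N i0 s : path A i0 s -> exists (x : X) p,
  [/\ path_of x = Infinite p, starts_with (i0 :: s) x & aperiodic_upto N p].
Proof.
move=> ps.
pose qs := [seq q <- allpairs pair (iota 0 N.+1) (iota 0 N.+1) | (q.1 < q.2)%N].
have [|s' As' sep] := path_separate_all (ps := qs) ps.
  by move=> q; rewrite mem_filter => /andP[].
have [p [Ap ep]] := path_extend_infinite As'.
exists (TerminalPath (Ap : is_terminal A (Infinite p))), p; split=> //.
  rewrite /starts_with /=; apply: (@eq_from_nth _ i0); first by rewrite size_mkseq.
  move=> k ks; rewrite nth_mkseq// ep; last first.
    by move: ks; rewrite /= ltnS size_cat => ks; rewrite (leq_trans ks)// leq_addr.
  by rewrite -cat_cons nth_cat ks.
move=> m n /andP[mn nN]; have [|k [k1 k2]] := sep (m, n).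
  rewrite mem_filter mn; apply/allpairsP; exists (m, n).
  by rewrite !mem_iota !add0n !ltnS nN (leq_trans (ltnW mn) nN).
exists k; rewrite /= in k1 k2; rewrite !ep//.
by rewrite -ltnS (ltn_trans _ k1)// ltn_add2r.
Qed.

Lemma starts_with_take (alpha beta : seq I) (y : X) : starts_with alpha y ->
  (size beta <= size alpha)%N -> starts_with beta y <-> beta = take (size beta) alpha.
Proof.
rewrite /starts_with /=; case: (path_of y) => [p ->|s J].
  by rewrite size_mkseq => ab; rewrite -map_take take_iota (minn_idPl ab).
rewrite !prefixE => /eqP <- ; rewrite size_take_min leq_min => /andP[ab _].
by rewrite take_takel//; split=> [/eqP|<-].
Qed.

(** The cylinders of the prefixes form a neighbourhood basis at an infinite path. The successor in
    the bound is there because [column_at (size d.1)] reads one entry beyond [d.1]. *)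
Lemma agree_infinite (L : seq (seq I * option I)) (x : X) p :
  path_of x = Infinite p -> exists n0, forall n, (n0 <= n)%N ->
  forall y, starts_with (mkseq p n) y -> agree L x y.
Proof.
move=> xp; exists (\max_(d <- L) size d.1).+1 => n Ln y sy d dL.
have sx : starts_with (mkseq p n) x by rewrite /starts_with /= xp size_mkseq.
have dn : (size d.1 < n)%N.
  by rewrite (leq_trans _ Ln)// ltnS; exact: (leq_bigmax_seq d).
have dn' : (size d.1 <= size (mkseq p n))%N by rewrite size_mkseq ltnW.
rewrite /basic_cylinder /= (starts_with_take sx dn') (starts_with_take sy dn').
case: d.2 => // j; rewrite -(size_mkseq p n) in dn.
by rewrite (column_at_starts dn sx (p 0)) (column_at_starts dn sy (p 0)).
Qed.

(** An infinite [z] is approximated by aperiodic extensions of a long prefix. For [(s; J)], an entry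
    [i] is appended to [s] whose column agrees with [J] on the letters that [L] tests, and the
    result is extended. *)
Lemma agree_aperiodic (z : X) (L : seq (seq I * option I)) N : exists (x : X) p,
  [/\ path_of x = Infinite p, agree L z x & aperiodic_upto N p].
Proof.
case ez: (path_of z) => [p|s J].
  have [n0 h] := agree_infinite L ez.
  have Ap : path A (p 0) (mkseq (fun k => p k.+1) n0).
    apply/(pathP (p 0)) => k; rewrite size_mkseq => kn; rewrite nth_mkseq//.
    have hp : forall k, A (p k) (p k.+1) by have := path_ofP z; rewrite ez.
    by case: k kn => [|k] kn //=; rewrite nth_mkseq// ltnW.
  have [x [q [xq sx aq]]] := aperiodic_extension N Ap.
  exists x, q; split=> //; apply: (h n0.+1) => //.
  by rewrite /mkseq /= -[1%N]addn0 iotaDl -map_comp.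
have [sA cJ lJ] : is_terminal A (Finite s J) by have := path_ofP z; rewrite ez.
have [i0] := hI.
pose letters := pmap (fun d : seq I * option I => d.2) L.
(* The last entry of [s] belongs to [J]; including it in [E] forces an edge from it to the chosen
   [i]. *)
pose E := [set j | j \in letters /\ J j] `|` [set j | exists s', s = rcons s' j].
pose F := [set j | j \in letters /\ ~ J j].
have finE : finite_set E.
  rewrite finite_setU; split; first by apply: sub_finite_set (finite_seq letters) => j [].
  apply: sub_finite_set (finite_seq s) => j [s' ->] /=.
  by rewrite mem_rcons mem_head.
have finF : finite_set F by apply: sub_finite_set (finite_seq letters) => j [].
have EJ : E `<=` J by move=> j [[]//|[s' /lJ]].
have FJ : F `<=` ~` J by move=> j [].
have infi := cJ E F finE finF EJ FJ.
(* Infinitely many candidates leave one that avoids the next entry of every [d.1] longer than [s]: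
   [z] is outside those cylinders, and the new path must be too. The default [i0] of [nth] merely
   excludes one more value. *)
have [i [[Ei Fi] iK]] : exists i, (E `<=` column A i /\ F `&` column A i = set0) /\
    i \notin [seq nth i0 d.1 (size s) | d <- L].
  apply/not_existsP => h; apply: infi.
  apply: sub_finite_set (finite_seq [seq nth i0 d.1 (size s) | d <- L]) => i hi /=.
  by apply: contrapT => /negP iK; apply: (h i).
have As : sorted A (rcons s i).
  have Es j s' : s = rcons s' j -> A j i by move=> e; apply: Ei; right; exists s'.
  case/lastP: s sA Es {ez cJ iK infi lJ E finE EJ Ei} => [|s j] // sA Es.
  rewrite -!cats1 -catA sorted_cat_cons sA /= andbT.
  exact: Es.
have [j [t et]] : exists j t, rcons s i = j :: t.
  by case: (s) => [|j t]; [exists i, [::]|exists j, (rcons t i)].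
have [x [p [xp sx ap]]] : exists (x : X) p,
    [/\ path_of x = Infinite p, starts_with (rcons s i) x & aperiodic_upto N p].
  by rewrite et in As *; exact: aperiodic_extension.
exists x, p; split=> // d dL.
have sz : starts_with s z by rewrite /starts_with /= ez prefix_refl.
have sxs : starts_with s x.
  apply/(starts_with_take sx); rewrite ?size_rcons//.
  by rewrite -cats1 take_size_cat.
rewrite /basic_cylinder /=.
have [ds|ds] := leqP (size d.1) (size s); last first.
  split=> -[h _]; exfalso.
    by move: h; rewrite /starts_with /= ez => /size_prefix; rewrite leqNgt ds.
  have ds' : (size (rcons s i) <= size d.1)%N by rewrite size_rcons.
  have /(starts_with_take h ds') e := sx; move/negP: iK; apply.
  apply/mapP; exists d => //; rewrite -(@nth_take (size s).+1)//.
  by rewrite size_rcons in e; rewrite -e nth_rcons ltnn eqxx.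
rewrite (starts_with_take sz ds) (starts_with_take sxs ds).
case ed: d.2 => [k|] //; have kl : k \in letters.
  by rewrite mem_pmap; apply/mapP; exists d.
move: ds; rewrite leq_eqVlt => /orP[/eqP ds|ds]; last first.
  by rewrite (column_at_starts ds sz i0) (column_at_starts ds sxs i0).
have dsi : (size d.1 < size (rcons s i))%N by rewrite size_rcons ds.
rewrite (column_at_starts dsi sx i0) nth_rcons ds ltnn eqxx.
rewrite {1}/column_at ez onth_default//; split=> -[de h]; split=> //.
  by apply: Ei; left.
apply: contrapT => nJ; have : (F `&` column A i) k by split.
by rewrite Fi.
Qed.

End Extension.

(** * Compactness of the cylinders *)

Section Subbase.
Variables (X : topologicalType) (D : set (set X)).
Hypothesis openX : forall U, @open X U <->
  exists2 D', D' `<=` finI_from D id & \bigcup_(V in D') V = U.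

Lemma subbase_open U : D U -> open U.
Proof.
move=> DU; apply/openX; exists [set U]; last by rewrite bigcup_set1.
by move=> _ ->; exact: (@finI_from1 _ _ D id).
Qed.

Lemma subbase_cvg (F : set_system X) (p : X) : Filter F ->
  (forall U, D U -> U p -> F U) -> F --> p.
Proof.
move=> FF h W; rewrite nbhsE => -[U [/openX[D' sD' eU] Up] UW].
move: Up; rewrite -eU => -[V D'V Vp].
have [E sE eV] := sD' _ D'V.
apply: filterS (UW) _; rewrite -eU; apply: (@filterS _ _ _ V).
  by move=> x Vx; exists V.
rewrite -eV; apply: filter_bigI => i iE; apply: h; first exact/set_mem/sE.
by move: Vp; rewrite -eV; apply.
Qed.

End Subbase.

Section Topology.
Variables (I : countType) (A : rel I).
Local Notation X := (terminal_path A).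
Local Notation G := (groupoid (@path_shift I A)).

Lemma open_terminal_path (U : set X) : open U <->
  exists2 D', D' `<=` finI_from [set U | @clopen_generators I A U \/
      clopen_generators (~` U)] id
    & \bigcup_(V in D') V = U.
Proof. by split=> -[D' h1 h2]; exists D'. Qed.

Lemma open_groupoid (U : set G) : open U <->
  exists2 D', D' `<=` finI_from (@basic_open _ (@path_shift I A)) id & \bigcup_(V in D') V = U.
Proof. by split=> -[D' h1 h2]; exists D'. Qed.

Lemma starts_with_sorted alpha (x : X) : starts_with alpha x -> sorted A alpha.
Proof.
rewrite /starts_with /=; case: x => -[p|s J] /= hx.
  move=> ->; apply/(sortedP (p 0%N)) => k; rewrite size_mkseq => kn.
  by rewrite !nth_mkseq// ltnW.
by move=> /prefixP[t es]; case: hx => + _ _; rewrite es => /cat_sorted2[].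
Qed.

Lemma clopen_basic_cylinder d :
  open (@basic_cylinder I A d) /\ open (~` @basic_cylinder I A d).
Proof.
have [sd|sd] := boolP (sorted A d.1).
  have cd : clopen_generators (@basic_cylinder I A d).
    exists d.1 => //; case ed: d.2 => [j|]; [right; exists j|left].
      by rewrite /basic_cylinder ed.
    by rewrite /basic_cylinder ed; apply/seteqP; split=> x //= [].
  split; apply: (subbase_open open_terminal_path); [by left|right].
  by rewrite setCK.
(* Not a generator when [d.1] is not a path, but then empty. *)
have -> : @basic_cylinder I A d = set0.
  by apply/seteqP; split=> x //= [/starts_with_sorted]; rewrite (negbTE sd).
by rewrite setC0; split; [exact: open0|exact: openT].
Qed.

Lemma clopen_generatorsE U : @clopen_generators I A U -> exists d, U = basic_cylinder d.
Proof.
move=> [alpha _ [->|[j ->]]]; last by exists (alpha, Some j).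
by exists (alpha, None); apply/seteqP; split=> x //= [].
Qed.

Lemma cvg_terminal_path (F : set_system X) (x : X) : Filter F ->
  (forall d, basic_cylinder d x -> F (basic_cylinder d)) ->
  (forall d, ~ basic_cylinder d x -> F (~` basic_cylinder d)) -> F --> x.
Proof.
move=> FF h1 h2; apply: (subbase_cvg open_terminal_path) => U.
case=> /clopen_generatorsE[d eU]; first by rewrite eU; exact: h1.
by rewrite -(setCK U) eU => /h2.
Qed.

Lemma starts_withW alpha n (x : X) : starts_with alpha x -> starts_with (take n alpha) x.
Proof.
move=> sx; apply/(starts_with_take sx); rewrite size_take_min ?geq_minr//.
by rewrite /minn; case: ltnP => // h; rewrite take_size take_oversize.
Qed.

Section Ultra.
Variable F : set_system X.
Hypothesis UF : UltraFilter F.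

Let FF : ProperFilter F := ultra_proper.

Lemma ultra_terminal_cvg (x : X) :
  (forall d, basic_cylinder d x <-> F (basic_cylinder d)) -> F --> x.
Proof.
move=> h; apply: cvg_terminal_path => d; first by move/h.
by move=> nd; have [/h//|//] := in_ultra_setVsetC (basic_cylinder d) UF.
Qed.

Lemma ultra_prefix alpha beta : F (starts_with alpha) -> F (starts_with beta) ->
  (size beta <= size alpha)%N -> beta = take (size beta) alpha.
Proof.
move=> Fa Fb ba; have [x [xa xb]] := filter_ex (filterI Fa Fb).
exact/(starts_with_take xa ba).
Qed.

(** The prefixes selected by [F] are compatible because sets of [F] meet; they assemble to the
    limit. *)
Lemma ultra_infinite : (forall n, exists2 alpha, size alpha = n & F (starts_with alpha)) ->
  exists x : X, F --> x.
Proof.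
move=> h.
have /choice[a aP] n : exists s, size s = n /\ F (starts_with s).
  by have [alpha] := h n; exists alpha.
have [i0 _] : exists i0 : I, True.
  by have [] := aP 1%N; case: (a 1%N) => // i0 s _ _; exists i0.
pose p n := nth i0 (a n.+1) n.
have ap n : a n = mkseq p n.
  apply: (@eq_from_nth _ i0); first by rewrite size_mkseq (aP n).1.
  rewrite (aP n).1 => k kn; rewrite nth_mkseq// /p.
  rewrite (ultra_prefix (aP n).2 (aP k.+1).2) ?(aP _).1//.
  by rewrite nth_take.
have hp : is_terminal A (Infinite p).
  move=> k; have [x sx] := filter_ex (aP k.+2).2.
  have hs := starts_with_sorted sx; rewrite ap in hs.
  by move/(sortedP i0)/(_ k): hs; rewrite size_mkseq ltnSn !nth_mkseq//; apply.
exists (TerminalPath hp); apply: ultra_terminal_cvg => d.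
have [n h'] := @agree_infinite _ _ [:: d] (TerminalPath hp) p erefl.
have Fn : F (starts_with (mkseq p n)) by rewrite -ap; exact: (aP n).2.
split=> hd; first by apply: filterS Fn => x /(h' n (leqnn n))/(_ d (mem_head _ _))[] /(_ hd).
by have [x [/(h' n (leqnn n))/(_ d (mem_head _ _))[_]]] := filter_ex (filterI Fn hd).
Qed.

Lemma last_column alpha i (x : X) : starts_with (rcons alpha i) x ->
  column_at (size alpha).+1 x i.
Proof.
move=> /starts_withP[v]; rewrite -cats1 raw_cat_cat => e.
have /starts_withP[w ew] : starts_with alpha x.
  apply/(starts_with_take (alpha := rcons alpha i)); rewrite ?size_rcons//.
    by apply/starts_withP; exists v; rewrite -cats1 raw_cat_cat.
  by rewrite -cats1 take_size_cat.
have [_ /= evw] := raw_cat_inj (erefl _) (etrans (esym e) ew).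
rewrite -addn1 (column_at_cat 1 ew) (column_at_cons 0 (esym evw)).
by apply/cons_terminal; exists w.
Qed.

(** The limit is [(alpha; J)], with [J] the set of [j] such that [F] contains the condition on I_r
    for [j]. For [J] to be a cluster point: were only finitely many columns compatible with [E] and
    [E'], [F] would contain the paths through [alpha] that satisfy these conditions and do not
    continue with one of those columns. Such a path must end at [alpha], with a cluster point [K]
    that is itself compatible with infinitely many columns. *)
Lemma ultra_finite alpha : F (starts_with alpha) ->
  (forall i, ~ F (starts_with (rcons alpha i))) -> exists x : X, F --> x.
Proof.
move=> Fa Fna; pose r := size alpha.
pose J := [set j | F (basic_cylinder (alpha, Some j))].
have cJ : column_cluster A J.
  move=> E E' finE finE' EJ E'J finQ; set Q := [set i | _] in finQ.
  have FE : F (\bigcap_(j in E) basic_cylinder (alpha, Some j)).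
    rewrite -(fset_setK finE); apply: filter_bigI => j.
    by rewrite in_fset_set// => /set_mem/EJ.
  have FE' : F (\bigcap_(j in E') ~` basic_cylinder (alpha, Some j)).
    rewrite -(fset_setK finE'); apply: filter_bigI => j.
    rewrite in_fset_set// => /set_mem/E'J nJ.
    by have [//|//] := in_ultra_setVsetC (basic_cylinder (alpha, Some j)) UF.
  have FQ : F (\bigcap_(i in Q) ~` starts_with (rcons alpha i)).
    rewrite -(fset_setK finQ); apply: filter_bigI => i _.
    by have [/Fna//|//] := in_ultra_setVsetC (@starts_with I A (rcons alpha i)) UF.
  have [x [sx [xE [xE' xQ]]]] :=
    filter_ex (filterI Fa (filterI FE (filterI FE' FQ))).
  have /starts_withP[v ev] := sx.
  have cv := column_at_cat 0 ev; rewrite addn0 in cv.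
  have EC : E `<=` column_at 0 v by move=> j /xE[_ /=]; rewrite cv.
  have E'C : E' `&` column_at 0 v = set0.
    by apply/seteqP; split=> j //= [/xE' nj vj]; apply: nj; split=> //=; rewrite cv.
  have nfirst k (w : X) : path_of v <> raw_cons k (path_of w).
    move=> e; rewrite (column_at_cons0 e) in EC E'C; apply: (xQ k) => //.
    by apply/starts_withP; exists w; rewrite -cats1 raw_cat_cat ev e.
  case: v ev cv EC E'C nfirst => -[p|[|k s] K] hv ev cv EC E'C nfirst.
  - have := nfirst (p 0%N) (TerminalPath (is_terminal_shift_infinite hv)); apply => /=.
    by congr Infinite; apply/funext => -[].
  - have [_ cK _] := hv; apply: (cK E E' finE finE') => //.
    by move=> j E'j Kj; have : (E' `&` K) j by [];
      rewrite -[K]/(column_at 0 (TerminalPath hv)) E'C.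
  - exact: (nfirst k (TerminalPath (is_terminal_shift_finite hv))).
have [x0 sx0] := filter_ex Fa.
have hx : is_terminal A (Finite alpha J).
  split=> //; first exact: starts_with_sorted sx0.
  move=> s i es; apply: filterS Fa => x sx; split=> //=.
  by rewrite es size_rcons; apply: last_column; rewrite -es.
pose y := TerminalPath hx.
have sy : starts_with alpha y by rewrite /starts_with /= prefix_refl.
exists y; apply: ultra_terminal_cvg => d.
(* A longer [d.1] in [F] would put some [rcons alpha j] in [F]. At equal length the column condition
   is the definition of [J]; below it, an entry of [alpha] decides. *)
have [ds|ds] := leqP (size d.1) (size alpha); last first.
  split=> [[]|Fd].
    by rewrite /starts_with /= => /size_prefix; rewrite leqNgt ds.
  exfalso; have [x [xa [xd _]]] := filter_ex (filterI Fa Fd).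
  have xt := starts_withW (size alpha).+1 xd.
  have et : take (size alpha) (take (size alpha).+1 d.1) = alpha.
    rewrite take_takel//; apply/esym/(starts_with_take xd) => //; exact: ltnW.
  have [j ej] : exists j, take (size alpha).+1 d.1 = rcons alpha j.
    case/lastP: (take _ _) (size_takel ds) et => // s j.
    rewrite size_rcons => -[ss]; rewrite -cats1 -ss take_size_cat// => ->.
    by exists j; rewrite cats1.
  apply: (Fna j); rewrite -ej; apply: filterS Fd => z [zd _]; exact: starts_withW.
have same : forall x : X, starts_with alpha x ->
    starts_with d.1 x <-> d.1 = take (size d.1) alpha.
  by move=> x sx; exact: starts_with_take.
case ed: d.2 => [j|]; last first.
  rewrite /basic_cylinder ed; split=> [[/(same _ sy) dt _]|Fd].
    by apply: filterS Fa => x sx; split=> //; apply/same.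
  have [x [xa [xd _]]] := filter_ex (filterI Fa Fd).
  by split=> //; apply/same => //; apply/(same x).
move: (ds); rewrite leq_eqVlt => /orP[/eqP sd|dlt].
  have -> : basic_cylinder d y <-> d.1 = alpha /\ J j.
    rewrite /basic_cylinder ed /=; rewrite (same _ sy) sd take_size.
    by rewrite /column_at /= onth_default.
  split=> [[da Jj]|Fd].
    by rewrite (_ : d = (alpha, Some j))// -da -ed; case: (d).
  have [x [xa [xd _]]] := filter_ex (filterI Fa Fd).
  have da : d.1 = alpha by move: xd => /(same x xa); rewrite sd take_size.
  by split=> //; rewrite /J /= (_ : (alpha, Some j) = d)// -da -ed; case: (d).
have [i0 _] : exists i0 : I, True by case: (alpha) dlt => // i0 *; exists i0.
have colE (x : X) : starts_with alpha x ->
    column_at (size d.1) x = column A (nth i0 alpha (size d.1)).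
  by move=> sx; exact: column_at_starts.
rewrite /basic_cylinder ed /=; split=> [[/(same _ sy) dt yj]|Fd].
  apply: filterS Fa => x sx; split; first exact/same.
  by rewrite colE// -(colE y).
have [x [xa [xd xj]]] := filter_ex (filterI Fa Fd).
split; first by apply/same => //; apply/(same x).
by rewrite colE// -(colE x).
Qed.

(** The empty prefix is always in [F], so if some length is missing there is a prefix in [F] with no
    one-letter extension in [F]. *)
Lemma ultra_cvg : exists x : X, F --> x.
Proof.
have [h|/existsNP[n nh]] := pselect (forall n,
    exists2 alpha, size alpha = n & F (starts_with alpha)).
  exact: ultra_infinite.
have [alpha Fa Fna] : exists2 alpha, F (starts_with alpha) &
    forall i, ~ F (starts_with (rcons alpha i)).
  elim: n nh => [|n IH] nh.
    exfalso; apply: nh; exists [::] => //.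
    by apply: filterS filterT => x _; exact: starts_with0.
  have [[alpha sa Fa]|/IH//] := pselect (exists2 alpha,
      size alpha = n & F (starts_with alpha)).
  by exists alpha => // i Fi; apply: nh; exists (rcons alpha i); rewrite ?size_rcons ?sa.
exact: ultra_finite Fa Fna.
Qed.

End Ultra.

Lemma compact_starts_with (alpha : seq I) : compact (@starts_with I A alpha).
Proof.
rewrite compact_ultra => F UF Fa; have [x Fx] := ultra_cvg UF.
exists x; split=> //; apply: contrapT => nx.
have [_ oC] := clopen_basic_cylinder (alpha, None).
have : F (~` basic_cylinder (alpha, None)).
  by apply: Fx; apply: open_nbhs_nbhs; split=> // -[].
by move=> /(filterI Fa)/filter_ex[y [ya]]; apply.
Qed.

End Topology.

(** * Arrows and the operators of words *)

Section Arrows.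
Variables (I : countType) (A : rel I).
Local Notation X := (terminal_path A).
Local Notation T := (@path_shift I A).
Local Notation G := (groupoid T).
Implicit Types (x y v : X) (g h k : G) (l : bool * I) (w : word I).

Lemma arrow_inj g h : tgt g = tgt h -> deg g = deg h -> src g = src h -> g = h.
Proof.
case: g h => [x k y p] [x' k' y' p'] /= ex ek ey; subst x' k' y'.
by congr Arrow; exact: Prop_irrelevance.
Qed.

Lemma partial_iterS n x : partial_iter T n.+1 x = obind (partial_iter T n) (T x).
Proof.
rewrite /partial_iter iterSr /=; case: (T x) => //=.
by elim: n => //= n ->.
Qed.

Lemma partial_iterP n x v : partial_iter T n x = Some v <->
  exists2 alpha, size alpha = n & path_of x = raw_cat alpha (path_of v).
Proof.
elim: n x => [|n IH] x.
  split=> [[->]|[alpha /size0nil -> /= /terminal_path_inj ->//]]; by exists [::].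
rewrite partial_iterS; split.
  case E: (T x) => [y|] //= /IH[alpha sa ey].
  have /path_shiftE[i ex] := E.
  by exists (i :: alpha); rewrite /= ?sa// ex ey.
move=> [[|i alpha] //= [sa] ex].
have : starts_with (i :: alpha) x by apply/starts_withP; exists v.
move=> /terminal_path_consP[y ey].
have /path_shiftE -> /= : exists i, path_of x = raw_cons i (path_of y) by exists i.
apply/IH; exists alpha => //.
by rewrite ey in ex; have [_ ->] := raw_cons_inj ex.
Qed.

(** For [(true, i)], this sends [g] to the [h] with g = s h and [s] in the bisection of S_i; for
    [(false, i)], it is the inverse map. *)
Definition letter_arrow l : G -> option G :=
  rel_fun (fun g h => [/\ letter l (tgt g) = Some (tgt h),
                          deg h = deg g - letter_deg l & src h = src g]).

Lemma letter_arrowP l g h : letter_arrow l g = Some h <->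
  [/\ letter l (tgt g) = Some (tgt h), deg h = deg g - letter_deg l & src h = src g].
Proof.
apply: rel_funP => g' h1 h2 [e1 d1 s1] [e2 d2 s2]; apply: arrow_inj.
- by move: e2; rewrite e1 => -[].
- by rewrite d1 d2.
- by rewrite s1 s2.
Qed.

Lemma letter_arrow_total l g z : letter l (tgt g) = Some z ->
  exists2 h, letter_arrow l g = Some h & tgt h = z.
Proof.
move=> e; suff p : exists m n : nat,
    deg g - letter_deg l = m%:Z - n%:Z /\ meet_at T m n z (src g).
  by exists (Arrow p) => //; apply/letter_arrowP.
have [m [n [-> [u um un]]]] := arrowP g.
case: l e => -[] i /=.
  move=> /strip_letterP ez.
  have sz : T (tgt g) = Some z by apply/path_shiftE; exists i.
  case: m um => [|m] um; last first.
    exists m, n; split; first by rewrite /letter_deg /= -addn1 PoszD; ring.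
    by exists u => //; move: um; rewrite partial_iterS sz.
  exists 0%N, n.+1; split; first by rewrite /letter_deg /= -addn1 PoszD; ring.
  exists z => //; rewrite /partial_iter iterS -/(partial_iter T n _) un /=.
  by move: um; rewrite /partial_iter /= => -[<-].
move=> /add_letterP ez.
have sz : T z = Some (tgt g) by apply/path_shiftE; exists i.
exists m.+1, n; split; first by rewrite /letter_deg /= -addn1 PoszD; ring.
by exists u => //; rewrite partial_iterS sz.
Qed.

Fixpoint word_arrow w g : option G :=
  if w is l :: w' then obind (word_arrow w') (letter_arrow l g) else Some g.

Lemma word_arrowP w g h : word_arrow w g = Some h <->
  [/\ word_act w (tgt g) = Some (tgt h), deg h = deg g - word_deg w & src h = src g].
Proof.
elim: w g => [|l w IH] g /=.
  rewrite word_deg0 subr0; split=> [[->//]|[[e1] e2 e3]].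
  by congr Some; exact: arrow_inj.
rewrite word_deg_cons; split.
  case E: (letter_arrow l g) => [k|] //= /IH[e1 e2 e3].
  have /letter_arrowP[f1 f2 f3] := E; rewrite f1 /= e1 e2 f2 e3 f3.
  by split=> //; rewrite opprD addrA.
move=> [+ e2 e3]; case E: (letter l (tgt g)) => [z|] //= e1.
have [k ek kz] := letter_arrow_total E; rewrite ek /=; apply/IH.
have /letter_arrowP[f1 f2 f3] := ek; rewrite kz f2 f3 e1.
by split=> //; rewrite e2 opprD addrA.
Qed.

Lemma word_arrow_inv w g h : word_arrow w g = Some h <-> word_arrow (word_inv w) h = Some g.
Proof.
split=> /word_arrowP[e1 e2 e3]; apply/word_arrowP; rewrite ?word_deg_inv in e2 *.
  by rewrite (iffLR (word_act_inv _ _ _) e1) e2 e3; split=> //; ring.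
by rewrite (iffRL (word_act_inv _ _ _) e1) e2 e3; split=> //; ring.
Qed.

Lemma word_arrow_injective w : partial_injection (word_arrow w).
Proof.
by move=> g h k /word_arrow_inv e /word_arrow_inv; rewrite e => -[].
Qed.

Lemma word_arrow_cat w w' : word_arrow (w ++ w') = obind (word_arrow w') \o word_arrow w.
Proof.
apply/funext => g /=; elim: w g => //= l w IH g.
by case: (letter_arrow l g) => //= h; rewrite IH.
Qed.

(** Words keep the source of an arrow, so identities between their operators can be checked on paths
    and degrees. *)
Lemma eq_word_arrow w w' : word_deg w = word_deg w' ->
  word_act w =1 @word_act _ A w' -> word_arrow w = word_arrow w'.
Proof.
move=> ed ea; apply/funext => g; case E: (word_arrow w g) => [h|].
  by apply/esym/word_arrowP; have /word_arrowP := E; rewrite ed ea.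
case E': (word_arrow w' g) => [h|] //.
by have /word_arrowP := E'; rewrite -ed -ea => /word_arrowP; rewrite E.
Qed.

End Arrows.

(** * The generators inside the groupoid algebra *)

Section Generators.
Variables (R : realType) (I : countType) (A : rel I).
Local Notation X := (terminal_path A).
Local Notation T := (@path_shift I A).
Local Notation G := (groupoid T).
Local Notation H := (l2 R G).

Definition word_op (w : word I) : H -> H := pull (word_arrow w).

Lemma word_opE w (f : H) g :
  word_op w f g = if word_arrow w g is Some h then f h else 0.
Proof. exact/pullE/word_arrow_injective. Qed.

Lemma word_op_bounded w : bounded_operator (word_op w).
Proof.
split; first exact/pull_linear/word_arrow_injective.
by exists 1 => f; rewrite mul1r l2norm_pull//; exact: word_arrow_injective.
Qed.

Lemma word_op_cat w w' : word_op (w ++ w') = word_op w \o word_op w'.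
Proof. by rewrite /word_op word_arrow_cat pull_comp//; exact: word_arrow_injective. Qed.

Lemma adjoint_word_op w : adjoint (word_op w) (word_op (word_inv w)).
Proof. by apply: adjoint_pull => g h; exact: word_arrow_inv. Qed.

(** An arrow of the bisection is determined by its target, so at most one term of the convolution at
    [k] is nonzero: the one with [g0], the arrow from [tgt h] to [tgt k]. *)
Lemma left_convolution_S i (a : H -> H) :
  left_convolution (S_fun R i) a <-> a = word_op [:: (true, i)].
Proof.
suff S_op (f : H) k : word_op [:: (true, i)] f k =
    \sum_(p \in [set p : G * G | is_product p.1 p.2 k]) S_fun R i p.1 * f p.2.
  split=> [ha|-> f k]; last exact: S_op.
  by apply/funext => f; apply: l2P => k; rewrite ha S_op.
rewrite word_opE /=.
have prodP (p : G * G) : is_product p.1 p.2 k -> S_fun R i p.1 * f p.2 <> 0 ->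
    letter_arrow (true, i) k = Some p.2.
  move=> [sg tk dk sk]; rewrite /S_fun indicE.
  case: (boolP (p.1 \in _)) => [|_]; last by rewrite mul0r.
  rewrite inE => -[/terminal_path_consP[y ey] d1 /path_shiftE[j ej]] _.
  apply/letter_arrowP; split.
  - apply/strip_letterP; rewrite tk -sg ej; congr raw_cons.
    by have [] := raw_cons_inj (etrans (esym ej) ey).
  - by rewrite dk d1 /letter_deg /=; ring.
  - by rewrite sk.
case E: (letter_arrow (true, i) k) => [h|] /=; last first.
  rewrite fsbig1// => p /prodP hp; apply: contrapT => nz.
  by move: (hp nz); rewrite E.
have /letter_arrowP[/strip_letterP e1 e2 e3] := E.
have p0 : exists m n : nat, (1 : int) = m%:Z - n%:Z /\ meet_at T m n (tgt k) (tgt h).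
  exists 1%N, 0%N; split; first by rewrite subr0.
  exists (tgt h) => //; rewrite /partial_iter /=.
  by apply/path_shiftE; exists i.
pose g0 := Arrow p0.
have P0 : is_product g0 h k by split=> //=; rewrite e2 /letter_deg /=; ring.
rewrite -(fsbig_widen [set (g0, h)]).
- rewrite fsbig_set1 /S_fun indicE mem_set ?mul1r//=; split=> //=.
    by apply/starts_withP; exists (tgt h).
  by apply/path_shiftE; exists i.
- by move=> _ ->.
- move=> p [pk np] /=; apply: contrapT => nz; apply: np.
  have := prodP _ pk nz; rewrite E => -[hp].
  case: p pk nz hp => g1 h1 /= pk nz hp; subst h1; congr (_, _).
  case: pk => /= sg tk dk _; apply: arrow_inj => //=.
  by apply: (@addIr _ (deg h)); rewrite -dk e2 /letter_deg /=; ring.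
Qed.

Definition S_bisection (i : I) : set G :=
  [set g | [/\ starts_with [:: i] (tgt g), deg g = 1 & T (tgt g) = Some (src g)]].

Lemma S_bisection_cons i g : S_bisection i g ->
  path_of (tgt g) = raw_cons i (path_of (src g)) /\ deg g = 1.
Proof.
move=> [/terminal_path_consP[y ey] dg /path_shiftE[j ej]]; split=> //.
by rewrite ej; congr raw_cons; have [] := raw_cons_inj (etrans (esym ej) ey).
Qed.

Lemma injective_partial_iter m (alpha : seq I) : size alpha = m ->
  injective_power T m (starts_with alpha).
Proof.
move=> sa; split=> [x /starts_withP[v ev]|x y /starts_withP[v ev] /starts_withP[w ew]].
  by rewrite (_ : partial_iter T m x = Some v)//; apply/partial_iterP; exists alpha.
have -> : partial_iter T m x = Some v by apply/partial_iterP; exists alpha.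
have -> : partial_iter T m y = Some w by apply/partial_iterP; exists alpha.
by move=> [vw]; apply: terminal_path_inj; rewrite ev ew vw.
Qed.

Lemma open_starts_with (alpha : seq I) : open (@starts_with I A alpha).
Proof.
have [+ _] := clopen_basic_cylinder A (alpha, None).
by congr open; apply/seteqP; split=> x //= [].
Qed.

Lemma open_S_bisection i : open (S_bisection i).
Proof.
apply: (subbase_open (@open_groupoid I A)).
exists 1%N, 0%N, (starts_with [:: i]), setT; split=> //.
- exact: open_starts_with.
- exact: openT.
- exact: injective_partial_iter.
- by split=> // x y _ _ [].
apply/seteqP; split=> g /=.
  move=> [sg dg Tg]; rewrite subr0; split=> //; exists (src g) => //.
by rewrite subr0 => -[sg dg _ [z z1 [zs]]]; split=> //; rewrite zs -z1.
Qed.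

(* An arrow (x, m - n, y) off the bisection has a neighbourhood off it: fix the
   first m entries of x and the first n entries of y. *)
Lemma closed_S_bisection i : closed (S_bisection i).
Proof.
rewrite -[S_bisection i]setCK; apply: open_closedC; rewrite openE => g ng.
have [m [n [dg [u /partial_iterP[alpha sa ea] /partial_iterP[beta sb eb]]]]] := arrowP g.
pose W : set G := [set h | [/\ deg h = m%:Z - n%:Z, starts_with alpha (tgt h),
  starts_with beta (src h) & meet_at T m n (tgt h) (src h)]].
have oW : open W.
  apply: (subbase_open (@open_groupoid I A)).
  exists m, n, (starts_with alpha), (starts_with beta); split=> //.
  - exact: open_starts_with.
  - exact: open_starts_with.
  - exact: injective_partial_iter.
  - exact: injective_partial_iter.
have Wg : W g.
  split=> //; try by apply/starts_withP; exists u.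
  by exists u; apply/partial_iterP; [exists alpha|exists beta].
apply: (@filterS _ _ _ W); last exact: open_nbhs_nbhs.
move=> h [dh ah bh _] /S_bisection_cons[eh dh1]; apply: ng.
have mn : m = n.+1.
  by apply/eqP; rewrite -eqz_nat -addn1 PoszD addrC -subr_eq -dh dh1.
case: alpha sa ea ah {W oW Wg} => [|a alpha]; rewrite mn// => -[sa] ea ah.
have [ai sh] := iffLR (starts_with_raw_cons alpha eh a) ah; subst a.
have ab : alpha = beta.
  by rewrite (iffLR (starts_with_take bh _) sh) sa -sb ?take_size.
split.
- have sg : starts_with (i :: alpha) (tgt g) by apply/starts_withP; exists u.
  by have := starts_withW 1 sg; rewrite /= take0.
- by rewrite dg -dh dh1.
- by apply/path_shiftE; exists i; rewrite ea eb ab.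
Qed.

(** Continuity of the shift on the cylinder of [i], at [x]: the preimage of a basic cylinder
    [(beta, j)] is [(i :: beta, j)]. *)
Lemma cvg_S_source i (x y : X) : path_of x = raw_cons i (path_of y) ->
  forall V : set X, nbhs y V ->
  \forall x' \near x, forall y' : X, path_of x' = raw_cons i (path_of y') -> V y'.
Proof.
move=> ex.
pose F : set_system X := [set V | \forall x' \near x,
  forall y' : X, path_of x' = raw_cons i (path_of y') -> V y'].
have FF : Filter F.
  split; first by apply: (@filterS _ (nbhs x) _ setT) filterT => ? _ ? *.
    move=> P Q FP FQ;
    apply: (@filterS _ (nbhs x) _ _ _ _ (@filterI _ (nbhs x) _ _ _ FP FQ)) => x' [hP hQ] y' e.
    by split; [exact: hP|exact: hQ].
  by move=> P Q PQ FP; apply: (@filterS _ (nbhs x) _ _ _ _ FP) => x' h y' /h/PQ.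
suff : F --> y by [].
have bc d (x' y' : X) : path_of x' = raw_cons i (path_of y') ->
    basic_cylinder (i :: d.1, d.2) x' <-> @basic_cylinder I A d y'.
  move=> e; rewrite /basic_cylinder /= (column_at_cons _ e).
  have hs := starts_with_raw_cons d.1 e i.
  by split=> -[h1 h2]; split=> //; [have [] := iffLR hs h1|exact: (iffRL hs)].
apply: cvg_terminal_path => d hd.
  have := (clopen_basic_cylinder A (i :: d.1, d.2)).1.
  rewrite openE => /(_ x); rewrite /interior /= => /(_ (iffRL (bc d x y ex) hd)).
  by apply: filterS => x' hx' y' e; apply/(bc d x' y' e).
have := (clopen_basic_cylinder A (i :: d.1, d.2)).2.
rewrite openE => /(_ x) /= h.
have nx : ~ basic_cylinder (i :: d.1, d.2) x by move=> /(bc d x y ex).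
by apply: filterS (h nx) => x' hx' y' e /(bc d x' y' e).
Qed.

(** The target map identifies the bisection with the cylinder of [i], which is compact: a cluster
    point of the targets is lifted to an arrow. *)
Lemma compact_S_bisection i : compact (S_bisection i).
Proof.
move=> F FF FB.
have [x [sx cx]] : starts_with [:: i] `&` cluster (@tgt _ T @ F) !=set0.
  apply: (compact_starts_with (alpha := [:: i])).
  by apply: (@filterS _ F _ _ _ _ FB) => g -[].
have [y ey] := terminal_path_consP sx.
have p0 : exists m n : nat, (1 : int) = m%:Z - n%:Z /\ meet_at T m n x y.
  exists 1%N, 0%N; split; first by rewrite subr0.
  by exists y => //; apply/path_shiftE; exists i.
pose g := Arrow p0; exists g; split.
  by split=> //; apply/path_shiftE; exists i.
(* The image of the neighbourhoods of [x] under the section that sends x' to the arrow (x', 1, T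
   x'); [Hg] is continuity of this section. *)
pose H0 : set_system G := [set W | \forall x' \near x,
  forall h, S_bisection i h -> tgt h = x' -> W h].
have FH : Filter H0.
  split; first by apply: (@filterS _ (nbhs x) _ setT) filterT => ? _ ? *.
    move=> P Q FP FQ;
    apply: (@filterS _ (nbhs x) _ _ _ _ (@filterI _ (nbhs x) _ _ _ FP FQ)) => x' [hP hQ] h Bh th.
    by split; [exact: hP|exact: hQ].
  by move=> P Q PQ FP; apply: (@filterS _ (nbhs x) _ _ _ _ FP) => x' hh h Bh /(hh _ Bh)/PQ.
have Hg : H0 --> g.
  apply: (subbase_cvg (@open_groupoid I A)) => _ [m [n [U [V [oU oV iU iV ->]]]]].
  move=> [/= d1 Ux Vy _].
  have nU : nbhs x U by exact: open_nbhs_nbhs.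
  have nV := cvg_S_source ey (open_nbhs_nbhs (conj oV Vy)).
  apply: filterS (filterI nU nV) => x' [Ux' Vx'] h Bh th.
  have [eh dh] := S_bisection_cons Bh; rewrite -th in Ux' Vx'.
  split=> //; [by rewrite dh|exact: Vx'|].
  have mn : m = n.+1.
    by apply/eqP; rewrite -eqz_nat -addn1 PoszD addrC -subr_eq -d1.
  have [/(_ _ Ux') def _] := iU.
  case E: (partial_iter T m (tgt h)) def => [z|] // _; exists z => //.
  move: E; rewrite mn partial_iterS.
  by rewrite (_ : T (tgt h) = Some (src h))//; apply/path_shiftE; exists i.
move=> V W FV /Hg nW.
have FVB : F (V `&` S_bisection i) by exact: filterI.
have [|x' [[h [Vh Bh] <-] hW]] := cx (@tgt _ T @` (V `&` S_bisection i)) _ _ nW.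
  by apply: (@filterS _ F _ _ _ _ FVB) => h hh; exists h.
by exists h; split=> //; exact: hW.
Qed.

Lemma Cc_S_fun i : Cc (S_fun R i : G -> R[i]).
Proof.
have S1 g : S_bisection i g -> S_fun R i g = 1.
  by move=> h; rewrite /S_fun indicE mem_set.
have S0 g : ~ S_bisection i g -> S_fun R i g = 0.
  by move=> h; rewrite /S_fun indicE memNset.
split.
  move=> g; have [Bg|Bg] := pselect (S_bisection i g).
    apply: (@cvg_near_cst _ R[i]^o (S_fun R i g) _ _ (nbhs_filter (g : G))).
    have : nbhs g (S_bisection i).
      by apply: open_nbhs_nbhs; split=> //; exact: open_S_bisection.
    by apply: filterS => h Bh; rewrite (S1 h Bh) (S1 g Bg).
  apply: (@cvg_near_cst _ R[i]^o (S_fun R i g) _ _ (nbhs_filter (g : G))).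
  have : nbhs g (~` S_bisection i).
    apply: open_nbhs_nbhs; split=> //.
    exact/closed_openC/closed_S_bisection.
  by apply: filterS => h Bh; rewrite (S0 h Bh) (S0 g Bg).
rewrite (_ : [set g | _] = S_bisection i).
  by rewrite -(closure_id _).1; [exact: compact_S_bisection|exact: closed_S_bisection].
apply/seteqP; split=> g /= => [/eqP nz|/S1 ->]; last exact: oner_neq0.
by apply: contrapT => /S0.
Qed.

Lemma groupoid_cstar_S i : groupoid_cstar (word_op [:: (true, i)]).
Proof.
split=> [|e e0]; first exact: word_op_bounded.
exists (word_op [:: (true, i)]).
  split; first exact: word_op_bounded.
  by exists (S_fun R i); [exact: Cc_S_fun|apply/left_convolution_S].
by move=> f; rewrite subrr l2norm0 mulr_ge0 ?l2norm_ge0// ltW.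
Qed.

End Generators.

(** * Spans of words and ideals *)

Section Span.
Variables (R : realType) (I : countType) (A : rel I).
Local Notation X := (terminal_path A).
Local Notation G := (groupoid (@path_shift I A)).
Local Notation H := (l2 R G).
Local Notation wop := (@word_op R I A).
Implicit Types (a b : H -> H) (w : word I) (f : H).

(* The empty word, which acts as the identity, is excluded: O_A need not be
   unital. *)
Inductive word_span : set (H -> H) :=
  | word_span0 : word_span 0
  | word_spanD (c : R[i]) w a : w <> [::] -> word_span a -> word_span (c *: wop w + a).

Lemma word_opB w f f' : wop w (f - f') = wop w f - wop w f'.
Proof.
have [l _] := word_op_bounded R A w.
by rewrite -(scaleN1r f') addrC l scaleN1r addrC.
Qed.

Lemma word_op0 w : wop w 0 = 0.
Proof. by have := word_opB w 0 0; rewrite !subrr. Qed.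

Lemma word_span_bounded : word_span `<=` @bounded_operator R G.
Proof.
move=> a; elim=> [|c w {}a _ _ IH]; first exact: bounded_operator0.
exact/bounded_operatorD/IH/bounded_operatorZ/word_op_bounded.
Qed.

Lemma word_span_add a b : word_span a -> word_span b -> word_span (a + b).
Proof.
by move=> sa sb; elim: sa => [|c w {}a w0 _ IH]; rewrite ?add0r// -addrA; exact: word_spanD.
Qed.

Lemma word_span_scale (z : R[i]) a : word_span a -> word_span (z *: a).
Proof.
elim=> [|c w {}a w0 _ IH]; first by rewrite scaler0; exact: word_span0.
by rewrite scalerDr scalerA; exact: word_spanD.
Qed.

Lemma word_span_mul a b : word_span a -> word_span b -> word_span (a \o b).
Proof.
move=> sa sb.
have wb w : w <> [::] -> word_span (wop w \o b).
  move=> w0; elim: sb => [|c w' {}b w'0 _ IH].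
    rewrite (_ : _ \o _ = 0); first exact: word_span0.
    by apply/funext => f /=; rewrite !op0E word_op0.
  rewrite (_ : _ \o _ = c *: wop (w ++ w') + (wop w \o b)).
    by apply: word_spanD => //; case: (w) w0.
  apply/funext => f; rewrite word_op_cat -[LHS]/(wop w (c *: wop w' f + b f)).
  by rewrite (proj1 (word_op_bounded R A w)).
elim: sa => [|c w {}a w0 _ IH]; first exact: word_span0.
rewrite (_ : _ \o _ = c *: (wop w \o b) + (a \o b))//.
by apply: word_span_add => //; apply: word_span_scale; exact: wb.
Qed.

Lemma word_inv_neq0 w : w <> [::] -> word_inv w <> [::].
Proof. by case: w => // l w _; rewrite word_inv_cons; case: (word_inv w). Qed.

Lemma word_span_adjoint a : word_span a -> exists2 b, word_span b & adjoint a b.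
Proof.
elim=> [|c w {}a w0 _ [b sb ab]].
  exists 0; first exact: word_span0.
  by move=> f g; rewrite !op0E l2dot0l l2dot0r.
exists (c^* *: wop (word_inv w) + b).
  exact/word_spanD/sb/word_inv_neq0.
move=> f g; rewrite !opDE !opZE l2dotDl l2dotDr l2dotZl l2dotZr ab.
by rewrite adjoint_word_op; congr (_ * _ + _); exact/esym/conjcK.
Qed.

Lemma word_span_star : star_algebra word_span.
Proof.
split.
- exact: word_span_bounded.
- exact: word_span0.
- exact: word_span_add.
- exact: word_span_scale.
- exact: word_span_mul.
- exact: word_span_adjoint.
Qed.

Lemma O_A_cstar : cstar_algebra (@O_A R I A).
Proof. by apply: smallest_cstar => a [[]]. Qed.

Lemma O_A_S i : O_A (wop [:: (true, i)]).
Proof.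
move=> M [_]; apply; split; first exact: groupoid_cstar_S.
by exists i; apply/left_convolution_S.
Qed.

Lemma O_A_word w : w <> [::] -> O_A (wop w).
Proof.
have O1 l : O_A (wop [:: l]).
  case: l => -[] i; first exact: O_A_S.
  apply: (cstar_adjoint O_A_cstar (O_A_S i)); first exact: word_op_bounded.
  exact: adjoint_word_op.
elim: w => // l w IH _; case: w IH => // l' w IH.
rewrite -cat1s word_op_cat; apply: (cstar_mul O_A_cstar) => //; exact: IH.
Qed.

(** By minimality of [O_A]: the closure of the span is a C*-algebra containing the generators. *)
Lemma O_A_sub : @O_A R I A `<=` norm_closure word_span.
Proof.
move=> a; apply; split; first exact/norm_closure_cstar/word_span_star.
move=> b [_ [i /left_convolution_S ->]]; split; first exact: word_op_bounded.
move=> e e0; exists (1 *: wop [:: (true, i)] + 0); first exact/word_spanD/word_span0.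
move=> f; rewrite addr0 scale1r subrr l2norm0 mulr_ge0 ?l2norm_ge0// ltW//.
Qed.

(** It carries membership in an ideal from [S_i] to its adjoint and from the projection of a
    cylinder to S_alpha. *)
Lemma word_op_partial_isometry w : wop (w ++ word_inv w ++ w) = wop w.
Proof.
rewrite /word_op; congr pull; apply: eq_word_arrow.
  by rewrite !word_deg_cat word_deg_inv; ring.
move=> x; rewrite !word_act_cat; case E: (word_act w x) => [y|] //=.
by rewrite word_act_cat (iffLR (word_act_inv _ _ _) E) /= E.
Qed.

Lemma ideal_word (J : set (H -> H)) w w' : closed_ideal (@O_A R I A) J ->
  J (wop w) -> w' != [::] -> J (wop (w ++ w')) /\ J (wop (w' ++ w)).
Proof.
move=> iJ Jw /eqP w0; rewrite !word_op_cat; split.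
  by apply: (ideal_mulr iJ) => //; exact: O_A_word.
by apply: (ideal_mull iJ) => //; exact: O_A_word.
Qed.

Lemma ideal_all (J : set (H -> H)) : closed_ideal (@O_A R I A) J ->
  (forall i, J (wop [:: (true, i)])) -> J = @O_A R I A.
Proof.
move=> iJ JS; apply/seteqP; split; first exact: ideal_sub.
have J1 l : J (wop [:: l]).
  case: l => -[] i; first exact: JS.
  rewrite -word_op_partial_isometry.
  have [_ J2] := ideal_word (w' := [:: (false, i)]) iJ (JS i) isT.
  by have [] := ideal_word (w' := [:: (false, i)]) iJ J2 isT.
have Jw w : w <> [::] -> J (wop w).
  case: w => // l w _; case: w => // l' w.
  by have [] := ideal_word (w' := l' :: w) iJ (J1 l) isT.
have Js a : word_span a -> J a.
  elim=> [|c w {}a w0 _ Ja]; first exact: (ideal_zero iJ).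
  by apply: (ideal_add iJ) => //; apply: (ideal_scale iJ); exact: Jw.
move=> a /O_A_sub[ba ha]; apply: (ideal_closed iJ); split=> // e /ha[b sb ab].
by exists b => //; exact: Js.
Qed.

Lemma raw_cat_terminal alpha j (x : X) : sorted A (rcons alpha j) ->
  starts_with [:: j] x -> exists u : X, path_of u = raw_cat alpha (path_of x).
Proof.
elim: alpha => [|k alpha IH] /= sa sx; first by exists x.
have [u eu] := IH (path_sorted sa) sx.
have su : starts_with (rcons alpha j) u.
  have /starts_withP[v ev] := sx.
  by apply/starts_withP; exists v; rewrite eu ev -cats1 raw_cat_cat.
have s0 : (0 < size (rcons alpha j))%N by rewrite size_rcons.
have /cons_terminal[z ez] : column_at 0 u k.
  rewrite (column_at_starts s0 su j) /column /=.
  by move: sa; case: (alpha) => [|l s] /= /andP[].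
by exists z; rewrite ez eu.
Qed.

(** Every path starting with [j] can be preceded by [alpha], so adding [alpha] and removing it again
    loses nothing before [j] is removed. *)
Lemma word_op_strip_last alpha j : sorted A (rcons alpha j) ->
  wop (word_inv (strips alpha) ++ strips (rcons alpha j)) = wop [:: (true, j)].
Proof.
move=> sa; rewrite /word_op; congr pull; apply: eq_word_arrow.
  rewrite word_deg_cat word_deg_inv !word_deg_strips size_rcons.
  by rewrite word_deg_cons word_deg0 /letter_deg /= -addn1 PoszD; ring.
move=> x; rewrite /strips map_rcons -cats1 !word_act_cat.
case E: (word_act (word_inv _) x) => [u|] /=.
  by rewrite word_act_cat (iffRL (word_act_inv _ _ _) E).
case E': (letter (true, j) x) => [v|] //=.
have sx : starts_with [:: j] x.
  by apply/starts_withP; exists v; apply/strip_letterP.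
have [u /stripsP/word_act_inv eu] := raw_cat_terminal sa sx.
by rewrite -/(strips alpha) eu in E.
Qed.

Lemma ideal_strips (J : set (H -> H)) alpha j : closed_ideal (@O_A R I A) J ->
  sorted A (rcons alpha j) -> J (wop (strips (rcons alpha j))) -> J (wop [:: (true, j)]).
Proof.
move=> iJ sa Ja; rewrite -(word_op_strip_last sa).
case: alpha sa Ja => [|k alpha] sa Ja //.
apply: (ideal_word iJ Ja _).2; exact/eqP/word_inv_neq0.
Qed.

(** The projection gives S_alpha for the path [rcons alpha i], a path from [i] to [j] prolongs it
    inside [J], and all but the last letter is then cancelled on the left. *)
Lemma ideal_cylinder (J : set (H -> H)) alpha i j : closed_ideal (@O_A R I A) J ->
  irreducible A -> sorted A (rcons alpha i) ->
  J (wop (cylinder_word (rcons alpha i))) -> J (wop [:: (true, j)]).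
Proof.
move=> iJ hirr sa Jp.
have Ja : J (wop (strips (rcons alpha i))).
  rewrite -word_op_partial_isometry catA.
  by apply: (ideal_word iJ Jp _).1; rewrite /strips; case: (alpha).
have [s ps ls] := hirr i j.
case/lastP: s ps ls => [|s k]; first by move=> _ /= <-; exact: ideal_strips Ja.
rewrite last_rcons => ps kj; subst k.
apply: (ideal_strips (alpha := rcons alpha i ++ s) iJ).
  by rewrite rcons_cat cat_rcons sorted_cat_cons sa.
rewrite rcons_cat /strips map_cat -/(strips _) -/(strips _).
by apply: (ideal_word iJ Ja _).1; rewrite /strips; case: (s).
Qed.

Lemma starts_with_drop alpha gamma (x v : X) : starts_with gamma x ->
  path_of x = raw_cat alpha (path_of v) -> (size alpha <= size gamma)%N ->
  starts_with (drop (size alpha) gamma) v.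
Proof.
move=> /starts_withP[u eu] ev ag; apply/starts_withP; exists u.
rewrite -(cat_take_drop (size alpha) gamma) raw_cat_cat ev in eu.
have sa : size alpha = size (take (size alpha) gamma) by rewrite size_takel.
by have [_ ->] := raw_cat_inj sa eu.
Qed.

Lemma starts_with_nth gamma gamma' (v : X) k i0 : starts_with gamma v ->
  starts_with gamma' v -> (k < size gamma)%N -> (k < size gamma')%N ->
  nth i0 gamma k = nth i0 gamma' k.
Proof.
move=> s1 s2 k1 k2; have s3 := starts_withW k.+1 s2.
have /(starts_with_take s1) : (size (take k.+1 gamma') <= size gamma)%N by rewrite size_takel.
move=> /iffLR/(_ s3) e; rewrite -(nth_take i0 (ltnSn k) gamma) -(nth_take i0 (ltnSn k) gamma').
by rewrite e size_takel.
Qed.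

(** If [tgt g] is in [D] and [alpha = beta], the word is the identity near [x] and its coefficient
    is 1. Otherwise both sides vanish: a path surviving the compression gives [v] such that
    [alpha v] and [beta v] start with the same long prefix of [p]. Equal lengths force
    [alpha = beta]; different lengths contradict aperiodicity. *)
Lemma word_local w g : exists L N, forall (x : X) p, path_of x = Infinite p ->
  agree L (tgt g) x -> aperiodic_upto N p ->
  exists n0, forall n, (n0 <= n)%N -> forall f,
    let P := wop (cylinder_word (mkseq p n)) in
    P (wop w (P f)) = wop w (delta R g) g *: P f.
Proof.
have [alpha [beta [D [[L DL] dw wD wND]]]] := word_normal_form A w.
exists L, (maxn (size alpha) (size beta)) => x p xp zx ap.
have [n1 h1] := agree_infinite L xp.
have [k hk] : exists k, size alpha <> size beta ->
    p (size alpha + k)%N <> p (size beta + k)%N.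
  case: (ltngtP (size alpha) (size beta)) => ab; last by exists 0%N.
  - have [|k hk] := ap (size alpha) (size beta); last by exists k.
    by rewrite ab leq_maxr.
  - have [|k hk] := ap (size beta) (size alpha).
      by rewrite ab leq_maxl.
    by exists k => _ /esym.
(* Long enough that the prefix decides membership in [D] and contains both entries that tell the two
   shifts of [p] apart. *)
exists (maxn n1 (maxn (size alpha) (size beta) + k).+1) => n nn f P.
have {nn} [n1n na nb] : [/\ (n1 <= n)%N, (size alpha + k < n)%N & (size beta + k < n)%N].
  move: nn; rewrite geq_max -addnS => /andP[-> nn]; split=> //.
    by rewrite -addnS (leq_trans _ nn)// leq_add2r leq_maxl.
  by rewrite -addnS (leq_trans _ nn)// leq_add2r leq_maxr.
have DE y : starts_with (mkseq p n) y -> D y <-> D (tgt g).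
  move=> sy; have zy := agree_trans zx (h1 n n1n y sy).
  by split; apply: DL => //; exact: agree_sym.
pose cw := cylinder_word (mkseq p n).
rewrite -[LHS]/((wop cw \o (wop w \o wop cw)) f) -!word_op_cat.
rewrite word_opE.
have [[Dz ab]|nDab] := pselect (D (tgt g) /\ alpha = beta).
  have fixw y : D y -> word_act w y = Some y.
    move=> /wD[v [y' [ey ey' ->]]]; congr Some; apply: terminal_path_inj.
    by rewrite ey ey' ab.
  have w0 : word_deg w = 0 by rewrite dw ab subrr.
  have -> : word_arrow w g = Some g.
    by apply/word_arrowP; rewrite fixw// w0 subr0.
  rewrite deltaE eqxx scale1r /P -/cw /word_op; congr (pull _ f).
  apply: eq_word_arrow.
    by rewrite /cw /cylinder_word !word_deg_cat w0 word_deg_inv; ring.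
  move=> y; rewrite word_act_cat.
  case E: (word_act cw y) => [y'|] //=.
  have /cylinder_wordP[yy' sy] := E; subst y'.
  by rewrite word_act_cat fixw ?(DE y sy)// /= E.
(* A word that fixes the arrow [g] has degree 0, so [alpha] and [beta] have equal length and are
   prefixes of one path. *)
have ng : word_arrow w g <> Some g.
  move=> /word_arrowP[e d _]; apply: nDab.
  have [Dz|/wND] := pselect (D (tgt g)); last by rewrite e.
  split=> //; have [v [y [ey ey' e']]] := wD _ Dz.
  have ty : tgt g = y by move: e'; rewrite e => -[].
  have sab : size alpha = size beta.
    apply/eqP; rewrite -eqz_nat -subr_eq0 -dw.
    by move/eqP: d; rewrite -subr_eq0 opprD addrA subrr add0r opprK.
  by have [] := raw_cat_inj sab (etrans (esym ey) (etrans (congr1 _ ty) ey')).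
rewrite (_ : (if _ is Some h then _ else _) = 0); last first.
  by case: (word_arrow w g) ng => // h hg; rewrite deltaE; case: eqVneq => // e;
    exfalso; apply: hg; rewrite e.
rewrite scale0r; apply: l2P => h; rewrite word_opE l20E.
case E: (word_arrow _ h) => [h'|] //; exfalso.
have /word_arrowP[+ _ _] := E; rewrite word_act_cat.
case E1: (word_act cw (tgt h)) => [y|] //=.
have /cylinder_wordP[hy sy] := E1; subst y.
rewrite word_act_cat; case E2: (word_act w (tgt h)) => [y|] //= E3.
have /cylinder_wordP[yh' sy'] := E3.
have Dh : D (tgt h) by apply: contrapT => /wND; rewrite E2.
have Dz : D (tgt g) by apply/(DE _ sy).
apply: nDab; split=> //.
have [v [y' [ev ev' e']]] := wD _ Dh.
move: e'; rewrite E2 => -[yy']; subst y'.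
have na' : (size alpha <= n)%N by rewrite (leq_trans _ (ltnW na))// leq_addr.
have nb' : (size beta <= n)%N by rewrite (leq_trans _ (ltnW nb))// leq_addr.
have [sab|sab] := pselect (size alpha = size beta).
  have ha : starts_with alpha (tgt h) by apply/starts_withP; exists v.
  have hb : starts_with beta y by apply/starts_withP; exists v.
  rewrite (iffLR (starts_with_take sy _) ha) ?size_mkseq//.
  by rewrite sab -(iffLR (starts_with_take sy' _) hb) ?size_mkseq.
exfalso; apply: (hk sab).
have va := starts_with_drop sy ev; have vb := starts_with_drop sy' ev'.
rewrite size_mkseq in va vb.
have := starts_with_nth (p 0%N) (va na') (vb nb') (k := k).
rewrite !size_drop !size_mkseq !ltn_subRL => /(_ na nb).
by rewrite !nth_drop !nth_mkseq.
Qed.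

(** [L] and [N] come before [x], because [x] is later chosen to suit them; only [n0] may depend on
    [x]. *)
Lemma span_local b g : word_span b -> exists L N, forall (x : X) p,
  path_of x = Infinite p -> agree L (tgt g) x -> aperiodic_upto N p ->
  exists n0, forall n, (n0 <= n)%N -> forall f,
    let P := wop (cylinder_word (mkseq p n)) in
    P (b (P f)) = b (delta R g) g *: P f.
Proof.
elim=> [|c w {}b _ _ [L [N h]]].
  exists [::], 0%N => x p xp _ _; exists 0%N => n _ f P.
  by rewrite !op0E /P word_op0 l20E scale0r.
have [L' [N' h']] := word_local w g.
exists (L ++ L'), (maxn N N') => x p xp /agree_cat[a a'] ap.
have [|n0 hn] := h x p xp a.
  by move=> m n /andP[mn nN]; apply: ap; rewrite mn (leq_trans nN)// leq_maxl.
have [|n0' hn'] := h' x p xp a'.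
  by move=> m n /andP[mn nN]; apply: ap; rewrite mn (leq_trans nN)// leq_maxr.
exists (maxn n0 n0') => n; rewrite geq_max => /andP[/hn {}hn /hn' {}hn'] f P.
have [lP _] := word_op_bounded R A (cylinder_word (mkseq p n)).
rewrite opDE opZE {1}/P lP -/P [P (wop w _)]hn' [P (b _)]hn opDE l2DE opZE l2ZE.
by rewrite scalerA -scalerDl.
Qed.

Lemma span_coord b g h : word_span b -> b (delta R g) h <> 0 ->
  exists2 w, w <> [::] & word_arrow w h = Some g.
Proof.
elim=> [|c w {}b w0 _ IH]; first by rewrite op0E.
rewrite opDE opZE l2DE l2ZE word_opE => nz.
case E: (word_arrow w h) nz => [h'|]; last by rewrite mulr0 add0r; exact: IH.
rewrite deltaE; case: eqVneq => [e|_]; first by exists w; rewrite // E e.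
by rewrite mulr0 add0r; exact: IH.
Qed.

End Span.

(** * Simplicity *)

Section Main.
Variables (R : realType) (I : countType) (A : rel I).
Hypotheses (hI : inhabited I) (hA : no_zero_rows A) (hL : condition_L A)
  (hirr : irreducible A).
Local Notation X := (terminal_path A).
Local Notation T := (@path_shift I A).
Local Notation G := (groupoid T).
Local Notation H := (l2 R G).
Local Notation wop := (@word_op R I A).
Implicit Types (a b : H -> H) (J : set (H -> H)).

Definition cmod (z : R[i]) : R := Num.sqrt (sqmod z).

Lemma cmod_coord (f : H) g : cmod (f g) <= l2norm f.
Proof. exact/ler_wsqrtr/sqmod_coord. Qed.

Lemma cmod_gt0 z : z <> 0 -> 0 < cmod z.
Proof.
move=> z0; rewrite sqrtr_gt0 lt_def sqmod_ge0 andbT.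
by apply/eqP => /sqmod_eq0.
Qed.

Lemma cmodV z : z <> 0 -> cmod z^-1 = (cmod z)^-1.
Proof.
move=> z0; have z1 : cmod z != 0 by rewrite gt_eqF ?cmod_gt0.
apply: (mulIf z1); rewrite mulVf// -sqrtrM ?sqmod_ge0// -sqmodM mulVf; last exact/eqP.
by rewrite /sqmod /= expr0n addr0 expr1n sqrtr1.
Qed.

Lemma O_A_neq0 : @O_A R I A != [set 0].
Proof.
apply/eqP => e; case: hI => i.
(* This provides an infinite path from [i]; with bound 0 the aperiodicity is vacuous. *)
have [x [p [xp sx _]]] :=
  aperiodic_extension hI hA hL hirr (A := A) 0 (i0 := i) (s := [::]) isT.
have [y ey] := terminal_path_consP sx.
have p0 : exists m n : nat, (0 : int) = m%:Z - n%:Z /\ meet_at T m n x x.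
  by exists 0%N, 0%N; split=> //; exists x.
pose g := Arrow p0.
have [h gh _] : exists2 h, letter_arrow (true, i) g = Some h & tgt h = y.
  by apply: letter_arrow_total; apply/strip_letterP.
have := @O_A_S R I A i; rewrite e => /= S0.
have : word_op [:: (true, i)] (delta R h) g = 0 by rewrite S0 op0E l20E.
rewrite word_opE [word_arrow _ _](_ : _ = Some h); last by rewrite /= gh.
by rewrite deltaE eqxx => /eqP; rewrite oner_eq0.
Qed.

Lemma ideal_diagonal J : closed_ideal (@O_A R I A) J -> J <> [set 0] ->
  exists a g, J a /\ a (delta R g) g <> 0.
Proof.
move=> iJ J0.
have [a Ja a0] : exists2 a, J a & a <> 0.
  apply: contrapT => h; apply: J0; apply/seteqP; split=> a /=.
    by move=> Ja; apply: contrapT => a0; apply: h; exists a.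
  by move=> ->; exact: (ideal_zero iJ).
have [ba ha] := O_A_sub (ideal_sub iJ Ja).
have [g [h agh]] := operator_coord_neq0 ba a0.
have c0 := cmod_gt0 agh.
(* An error below the modulus of the coefficient keeps that of [b] nonzero, and then some word of
   [b] links the two arrows; its inverse moves the coefficient of [a] to the diagonal. *)
have [b sb ab] := ha _ (divr_gt0 c0 (ltr0Sn _ 1)).
have bgh : b (delta R g) h <> 0.
  move=> bgh; have := ab (delta R g); rewrite leNgt => /negP; apply.
  rewrite (lt_le_trans _ (cmod_coord _ h))// l2BE bgh subr0.
  rewrite (le_lt_trans (ler_piMr _ (l2norm_delta _ _)))//.
    by rewrite divr_ge0// ltW.
  by rewrite ltr_pdivrMr// ltr_pMr// ltr1n.
have [w w0 wh] := span_coord sb bgh.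
exists (wop (word_inv w) \o a), g; split.
  by apply: (ideal_mull iJ) => //; apply: O_A_word; exact: word_inv_neq0.
have wi : word_arrow (word_inv w) g = Some h by exact: (iffLR (word_arrow_inv _ _ _) wh).
by rewrite -[X in X <> _]/(wop (word_inv w) (a (delta R g)) g) word_opE wi.
Qed.

Lemma ideal_contains_cylinder J a g : closed_ideal (@O_A R I A) J -> J a ->
  a (delta R g) g <> 0 -> exists alpha i, sorted A (rcons alpha i) /\
    J (wop (cylinder_word (rcons alpha i))).
Proof.
move=> iJ Ja; set c := a (delta R g) g => c0.
have cp := cmod_gt0 c0.
have [_ ha] := O_A_sub (ideal_sub iJ Ja).
(* One quarter pays for replacing the coefficient of [b] by [c], another for replacing [b] by [a] in
   the compression; together they give the 1/2 of [ideal_approx]. *)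
have [b sb ab] := ha _ (divr_gt0 cp (ltr0Sn _ 3)).
have [L [N locb]] := span_local g sb.
have [x [p [xp zx ap]]] := agree_aperiodic hI hA hL hirr (tgt g) L N.
have [n0 hn] := locb x p xp zx ap.
have sm m : starts_with (mkseq p m) x by rewrite /starts_with /= xp size_mkseq.
(* Length [n0.+1] makes the prefix nonempty, so that it has a last entry from which irreducibility
   can continue. *)
have [alpha [i ea]] : exists alpha i, mkseq p n0.+1 = rcons alpha i.
  by exists (mkseq p n0), (p n0); rewrite /mkseq -addn1 iotaD map_cat cats1.
have {}hn := hn n0.+1 (leqnSn n0); have sx := sm n0.+1; rewrite ea in hn sx.
exists alpha, i; split; first exact: starts_with_sorted sx.
set cw := cylinder_word (rcons alpha i).
have Pnorm f : l2norm (wop cw f) <= l2norm f.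
  exact/l2norm_pull/word_arrow_injective.
have PP f : wop cw (wop cw f) = wop cw f.
  rewrite -[LHS]/((wop cw \o wop cw) f) -word_op_cat; congr (pull _ f).
  apply: eq_word_arrow.
    by rewrite word_deg_cat /cw /cylinder_word word_deg_cat word_deg_inv; ring.
  move=> y; rewrite word_act_cat; case E: (word_act cw y) => [y'|] //=.
  by have /cylinder_wordP[yy _] := E; rewrite -yy E yy.
have OP : O_A (wop cw).
  by apply: O_A_word; rewrite /cw /cylinder_word /strips; case: (alpha).
have [lP _] := word_op_bounded R A cw.
pose y := c^-1 *: (wop cw \o a \o wop cw).
apply: (ideal_approx (b := y) (@O_A_cstar R I A) iJ OP Pnorm PP).
- apply: (ideal_scale iJ); apply: (ideal_mulr iJ) => //.
  exact: (ideal_mull iJ).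
- by move=> f; rewrite /y !opZE /= PP.
move=> f.
have e0 : wop cw f - y f =
    c^-1 *: ((c - b (delta R g) g) *: wop cw f - wop cw (a (wop cw f) - b (wop cw f))).
  rewrite word_opB (hn f) -/cw /y opZE /= scalerBl opprB addrA subrK scalerBr.
  by rewrite scalerA mulVf ?scale1r//; exact/eqP.
rewrite e0 l2normZ -/(cmod _) cmodV// mulrC ler_pdivrMr//.
have d1 : cmod (c - b (delta R g) g) <= cmod c / 4.
  rewrite (le_trans (cmod_coord (a (delta R g) - b (delta R g)) g))//.
  rewrite (le_trans (ab _))// ler_piMr ?l2norm_delta// divr_ge0// ltW//.
have d2 : l2norm (a (wop cw f) - b (wop cw f)) <= cmod c / 4 * l2norm f.
  rewrite (le_trans (ab _))// ler_wpM2l// divr_ge0// ltW//.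
rewrite (le_trans (l2normB _ _))//.
have -> : 2^-1 * l2norm f * cmod c = cmod c / 4 * l2norm f + cmod c / 4 * l2norm f by field.
apply: lerD; last exact: le_trans (Pnorm _) d2.
rewrite l2normZ -/(cmod _) (le_trans (ler_wpM2r (l2norm_ge0 _) d1))//.
by rewrite ler_wpM2l// divr_ge0// ltW.
Qed.

End Main.

Theorem proposition4p9 (R : realType) (I : countType) (A : rel I)
    (hI : inhabited I) (hA : no_zero_rows A) (hL : condition_L A)
    (hirr : irreducible A) :
  simple_cstar_algebra (@O_A R I A).
Proof.
split; [exact: O_A_cstar|exact: O_A_neq0|].
move=> J iJ; have [->|J0] := pselect (J = [set 0]); [by left|right].
have [a [g [Ja ag]]] := ideal_diagonal iJ J0.
have [alpha [i [sa Jp]]] := ideal_contains_cylinder hI hA hL hirr iJ Ja ag.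
by apply: (ideal_all iJ) => j; exact: ideal_cylinder Jp.
Qed.
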